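(* Let $p>1$, $\gamma>1$, $N\ge1$, and let $u\in C^{1,\alpha}(\mathbb{R}^N_+)\cap C(\overline{\mathbb{R}^N_+})$ be a weak solution of $$-\Delta_p u=\frac{1}{u^\gamma}\ \text{ in }\mathbb{R}^N_+,\qquad u>0\ \text{ in }\mathbb{R}^N_+,\qquad u=0\ \text{ on }\partial\mathbb{R}^N_+,$$ such that $$\underline{c}\,x_N^\beta\le u(x)\le\overline{C}\,x_N^\beta\quad\text{for all }x\in\mathbb{R}^N_+,\qquad\text{with }\beta:=\frac{p}{\gamma+p-1},$$ for some positive constants $\underline{c},\overline{C}$. Then $$u(x)=u(x_N)=M\,x_N^\beta\qquad\text{with}\quad M:=\left[\frac{(\gamma+p-1)^p}{p^{p-1}(p-1)(\gamma-1)}\right]^{\frac{1}{\gamma+p-1}}.$$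
   Context: $\mathbb{R}^N_+:=\{x=(x_1,\dots,x_N)\in\mathbb{R}^N: x_N>0\}$. $\Delta_p u=\operatorname{div}(|\nabla u|^{p-2}\nabla u)$. $C^{1,\alpha}(\mathbb{R}^N_+)$ (for some $\alpha\in(0,1)$) is understood locally in the open half space. The equation is understood in the weak sense: $$\int_{\mathbb{R}^N_+}|\nabla u|^{p-2}(\nabla u,\nabla\varphi)\,dx=\int_{\mathbb{R}^N_+}\frac{\varphi}{u^\gamma}\,dx\qquad\forall\varphi\in C_c^\infty(\mathbb{R}^N_+).$$ *)

(* Defs.v *)
From HB Require Import structures.
From mathcomp Require Import all_boot all_order all_algebra.
From mathcomp Require Import all_classical all_reals all_analysis.

Set Implicit Arguments.
Unset Strict Implicit.
Unset Printing Implicit Defensive.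

Import Order.TTheory GRing.Theory Num.Theory.
Import numFieldNormedType.Exports.

Local Open Scope classical_set_scope.
Local Open Scope ring_scope.

(* 'rV[R]_n carries the product sigma-algebra, generated by the coordinates;
   it is the Borel sigma-algebra of R^n. *)
Definition rV_coord {R : realType} {n} (i : 'I_n) (v : 'rV[R]_n) :
  measurableTypeR R := v ord0 i.

Section measurable_rV.
Context {R : realType} {n : nat}.

Let rV_set0 : g_sigma_preimage (@rV_coord R n) set0.
Proof. exact: sigma_algebra0. Qed.

Let rV_setC A : g_sigma_preimage (@rV_coord R n) A ->
  g_sigma_preimage (@rV_coord R n) (~` A).
Proof. exact: sigma_algebraC. Qed.

Let rV_bigcup (F : (set 'rV[R]_n)^nat) :
  (forall i, g_sigma_preimage (@rV_coord R n) (F i)) ->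
  g_sigma_preimage (@rV_coord R n) (\bigcup_i F i).
Proof. exact: sigma_algebra_bigcup. Qed.

HB.instance Definition _ :=
  @isMeasurable.Build (measure_tuple_display (R.-ocitv.-measurable).-sigma)
    'rV[R]_n (g_sigma_preimage (@rV_coord R n)) rV_set0 rV_setC rV_bigcup.

End measurable_rV.

Lemma measurable_rV_coord {R : realType} n (i : 'I_n) :
  measurable_fun setT (@rV_coord R n i).
Proof.
move=> _ Y mY; rewrite setTI; apply: sub_sigma_algebra => /=.
rewrite -bigcup_seq/=; exists i => /=; first by rewrite mem_index_enum.
by exists Y => //; rewrite setTI.
Qed.

Lemma measurable_fun_rVP {R : realType} {d} {T : measurableType d} n
    (f : T -> 'rV[R]_n) :
  (forall i, measurable_fun setT (rV_coord i \o f)) -> measurable_fun setT f.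
Proof.
move=> mf _ A mA; rewrite setTI.
have mF : g_sigma_preimage (fun i => rV_coord i \o f) `<=` measurable.
  apply: smallest_sub; first exact: sigma_algebra_measurable.
  by rewrite -bigcup_seq => B [i _ [C mC <-]]; exact: mf.
apply: mF; rewrite g_sigma_preimage_comp; exists A => //.
by rewrite setTI.
Qed.

Section rV_cons.
Context {R : realType} {n : nat}.

Definition rV_cons (xv : measurableTypeR R * 'rV[R]_n) : 'rV[R]_n.+1 :=
  row_mx (xv.1 : R)%:M xv.2.

Definition rV_split (v : 'rV[R]_n.+1) : measurableTypeR R * 'rV[R]_n :=
  (v ord0 ord0, \row_i v ord0 (lift ord0 i)).

Lemma rV_cons0 xv : rV_cons xv ord0 ord0 = xv.1.
Proof.
rewrite /rV_cons (_ : ord0 = lshift n (ord0 : 'I_1)); last exact: val_inj.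
by rewrite (row_mxEl (xv.1%:M : 'rV_1)) mxE.
Qed.

Lemma rV_consS xv i : rV_cons xv ord0 (lift ord0 i) = xv.2 ord0 i.
Proof.
rewrite /rV_cons (_ : lift ord0 i = rshift 1 i); last exact: val_inj.
by rewrite (row_mxEr (xv.1%:M : 'rV_1)).
Qed.

Lemma rV_consK : cancel rV_cons rV_split.
Proof.
case=> x v; congr pair; first exact: rV_cons0.
by apply/rowP => i; rewrite mxE rV_consS.
Qed.

Lemma measurable_rV_cons : measurable_fun setT rV_cons.
Proof.
apply: measurable_fun_rVP => i; have [j ->|->] := unliftP ord0 i.
- rewrite (_ : _ \o _ = rV_coord j \o snd).
    by apply: measurableT_comp => //; exact: measurable_rV_coord.
  by apply/funext => xv; rewrite /= /rV_coord rV_consS.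
- rewrite (_ : _ \o _ = fst)//.
  by apply/funext => xv; rewrite /= /rV_coord rV_cons0.
Qed.

Lemma measurable_rV_split : measurable_fun setT rV_split.
Proof.
apply/measurable_fun_pairP; split; first exact: (measurable_rV_coord ord0).
apply: measurable_fun_rVP => i.
rewrite (_ : _ \o _ = rV_coord (lift ord0 i)); first exact: measurable_rV_coord.
by apply/funext => v; rewrite /= /rV_coord mxE.
Qed.

HB.instance Definition _ :=
  isMeasurableFun.Build _ _ _ _ rV_cons measurable_rV_cons.

End rV_cons.

Section lebesgue_rV_succ.
Context {R : realType} {n : nat}.
Variable m : {sigma_finite_measure set 'rV[R]_n -> \bar R}.

Definition lebesgue_rV_succ : set 'rV[R]_n.+1 -> \bar R :=
  pushforward (lebesgue_measure \x m)%E rV_cons.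

Let lebesgue_rV_succ0 : lebesgue_rV_succ set0 = 0%E.
Proof. exact: measure0. Qed.

Let lebesgue_rV_succ_ge0 A : (0 <= lebesgue_rV_succ A)%E.
Proof. exact: measure_ge0. Qed.

Let lebesgue_rV_succ_sigma_additive : semi_sigma_additive lebesgue_rV_succ.
Proof. exact: measure_semi_sigma_additive. Qed.

HB.instance Definition _ := isMeasure.Build _ _ _ lebesgue_rV_succ
  lebesgue_rV_succ0 lebesgue_rV_succ_ge0 lebesgue_rV_succ_sigma_additive.

Let lebesgue_rV_succ_sigma_finite : sigma_finite setT lebesgue_rV_succ.
Proof.
have /sigma_finiteP[F [FT ndF Foo]] := sigma_finiteT (@lebesgue_measure R).
have /sigma_finiteP[G [GT ndG Goo]] := sigma_finiteT m.
exists (fun k => rV_split @^-1` (F k `*` G k)).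
  apply/esym; rewrite -subTset => v _.
  have [k _ Fk] : (\bigcup_k F k) (rV_split v).1 by rewrite -FT.
  have [l _ Gl] : (\bigcup_k G k) (rV_split v).2 by rewrite -GT.
  exists (maxn k l) => //; split.
    exact: (subsetPset _ _ (ndF _ _ (leq_maxl k l))).
  exact: (subsetPset _ _ (ndG _ _ (leq_maxr k l))).
move=> k; have [mF Fkoo] := Foo k; have [mG Gkoo] := Goo k; split.
  by rewrite -[X in measurable X]setTI; apply: measurable_rV_split => //;
    exact: measurableX.
rewrite /lebesgue_rV_succ /pushforward -comp_preimage.
rewrite (_ : rV_split \o rV_cons = id); last first.
  by apply/funext => xv; exact: rV_consK.
by rewrite preimage_id product_measure1E// lte_mul_pinfty// ge0_fin_numE.
Qed.

HB.instance Definition _ := Measure_isSigmaFinite.Build _ _ _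
  lebesgue_rV_succ lebesgue_rV_succ_sigma_finite.

End lebesgue_rV_succ.

Fixpoint lebesgue_rV {R : realType} (n : nat) :
    {sigma_finite_measure set 'rV[R]_n -> \bar R} :=
  match n with
  | 0 => \d_(0 : 'rV[R]_0)
  | n'.+1 => lebesgue_rV_succ (lebesgue_rV n')
  end.

Lemma lebesgue_rV_box {R : realType} (n : nat)
    (A : 'I_n -> set (measurableTypeR R)) : (forall i, measurable (A i)) ->
  lebesgue_rV n [set v : 'rV[R]_n | forall i, A i (v ord0 i)] =
  (\prod_(i < n) lebesgue_measure (A i))%E.
Proof.
elim: n A => [|n IHn] A mA.
  rewrite big_ord0 (_ : mkset _ = setT); first exact: diracT.
  by apply/seteqP; split => // v _ [].
rewrite big_ord_recl -IHn//=.
rewrite /lebesgue_rV_succ /pushforward /=.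
rewrite -product_measure1E//; last first.
  rewrite (_ : [set v | _] = \big[setI/setT]_(i < n)
    (rV_coord i @^-1` A (lift ord0 i))).
    apply: bigsetI_measurable => i _.
    by rewrite -[X in measurable X]setTI; exact: measurable_rV_coord.
  rewrite -bigcap_seq; apply/seteqP; split => [v Av i _|v Av i]; first exact: Av.
  by apply: Av; rewrite /= mem_index_enum.
congr (product_measure1 _ _ _); apply/seteqP; split => [xv Axv|xv [A0 AS] i].
  split; first by have := Axv ord0; rewrite rV_cons0.
  by move=> i; have := Axv (lift ord0 i); rewrite rV_consS.
by have [j ->|->] := unliftP ord0 i; rewrite ?rV_consS ?rV_cons0//; exact: AS.
Qed.

Section euclidean.
Context {R : realType} {n : nat}.
Implicit Types (v w x : 'rV[R]_n) (f : 'rV[R]_n -> R).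

Definition dotv v w : R := \sum_(i < n) v ord0 i * w ord0 i.

(* The library norm of 'rV[R]_n is the sup norm. *)
Definition enorm v : R := Num.sqrt (dotv v v).

Definition partial (i : 'I_n) f : 'rV[R]_n -> R := 'D_(delta_mx ord0 i) f.

Definition grad f x : 'rV[R]_n := \row_(i < n) partial i f x.

(* [Omega] is meant to be open: the derivatives are taken in the whole space. *)
Fixpoint Ck (k : nat) (Omega : set 'rV[R]_n) f : Prop :=
  match k with
  | 0 => {within Omega, continuous f}
  | k'.+1 => {within Omega, continuous f} /\
      forall i : 'I_n,
        (forall x, Omega x -> derivable f x (delta_mx ord0 i)) /\
        Ck k' Omega (partial i f)
  end.

Definition C1_holder_loc (alpha : R) (Omega : set 'rV[R]_n) f : Prop :=
  Ck 1 Omega f /\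
  forall K : set 'rV[R]_n, compact K -> K `<=` Omega ->
    exists C : R, forall x y, K x -> K y ->
      enorm (grad f x - grad f y) <= C * enorm (x - y) `^ alpha.

Definition test_function (Omega : set 'rV[R]_n) f : Prop :=
  [/\ forall k, Ck k setT f,
      compact (closure [set x | f x != 0]) &
      closure [set x | f x != 0] `<=` Omega].

End euclidean.

Definition boundary {T : topologicalType} (A : set T) : set T :=
  closure A `\` interior A.

Section half_space.
Context {R : realType} {n : nat}.
Implicit Types (x : 'rV[R]_n.+1) (u : 'rV[R]_n.+1 -> R).

Definition half_space : set 'rV[R]_n.+1 := [set x | 0 < x ord0 ord_max].

(* When p < 2 and the gradient vanishes, [powR] makes the flux
   |grad u|^(p-2) grad u equal to 0, as it should be for p > 1. *)
Definition weak_solution (p gamma : R) u : Prop :=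
  forall phi : 'rV[R]_n.+1 -> R, test_function half_space phi ->
    (\int[lebesgue_rV n.+1]_(x in half_space)
        (enorm (grad u x) `^ (p - 2) * dotv (grad u x) (grad phi x))%:E =
     \int[lebesgue_rV n.+1]_(x in half_space) (phi x / u x `^ gamma)%:E)%E.

End half_space.
Arguments half_space {R} n.

Definition beta_exponent {R : realType} (p gamma : R) : R :=
  p / (gamma + p - 1).

Definition M_const {R : realType} (p gamma : R) : R :=
  ((gamma + p - 1) `^ p / (p `^ (p - 1) * (p - 1) * (gamma - 1)))
    `^ (1 / (gamma + p - 1)).

(* Main.v *)
Require Import Defs.
From mathcomp Require Import all_boot all_order all_algebra.
From mathcomp Require Import ring lra.
From mathcomp Require Import all_classical all_reals all_analysis measurable_realfun.
Import Order.TTheory GRing.Theory Num.Theory.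
Import numFieldNormedType.Exports.
Local Open Scope classical_set_scope.
Local Open Scope ring_scope.
Set Implicit Arguments.
Unset Strict Implicit.
Unset Printing Implicit Defensive.

(* Let v = M x_N^beta and a = sup u / x_N^beta.  If a > M, then a x_N^beta is a
   strict supersolution.  For a point x0 at height h, the function
     w(x) = a x_N^beta + k h^(beta-2) (|x - x0|^2 - (r h)^2) / 2
   lies above a x_N^beta >= u off the ball |x - x0| < r h, and for k and r small,
   depending only on a because the problem is invariant under translations in
   x' and under u(x) |-> s^(-beta) u(s x), it is still a strict classical
   supersolution with nonvanishing gradient near that ball.  Comparison gives
   u(x0) <= w(x0) = (a - k r^2 / 2) h^beta for every x0, which contradicts the
   choice of a; hence no compactness of translated and rescaled solutions is
   needed.  The infimum is treated in the same way, with the sign [sigma] = -1.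

   Comparison tests the equations of u and w with max(u - w, 0)^2, which is of
   class C^1 with compact support. *)

(** * Lebesgue measure on row vectors *)

(** The exponent beta is the one for which the two sides of the equation for a x_N^beta are
    multiples of the same power of x_N. What remains is a comparison of a multiple of a^(p-1) with
    a^(-gamma), whose difference changes sign exactly at a = M. The obstacle is that the p-Laplacian
    is singular or degenerate where the gradient vanishes. Near x0 the barrier is a small
    perturbation of a profile with nonzero gradient, so its flux can be differentiated; nothing of
    the kind is known for u, whose equation is used only in weak form. The test function is built
    from u itself and is only of class C^1, whereas the weak formulation admits smooth functions:
    extending it by mollification is what calls for translation invariance, Fubini's theorem and
    bumps. The barrier is a sum of functions of one variable, so that its Hessian is diagonal and
    one-variable calculus gives its p-Laplacian. In the comparison, the monotonicity of the flux and
    the decrease of t^(-gamma) cooperate: where u > w, the right-hand side for u is smaller than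
    w^(-gamma). *)

Lemma lebesgue_measure_shift (R : realType) (a : R)
    (A : set (measurableTypeR R)) : measurable A ->
  lebesgue_measure ((fun x : measurableTypeR R => (x : R) + a) @^-1` A)
  = lebesgue_measure A.
Proof.
move=> mA.
have mf : measurable_fun [set: measurableTypeR R]
    ((fun x => (x : R) + a) : measurableTypeR R -> measurableTypeR R).
  by apply: measurable_funD => //; exact: measurable_id.
pose m : {measure set (measurableTypeR R) -> \bar R} :=
  measure_function_pushforward__canonical__measure_function_Measure
    (@lebesgue_measure R) mf.
apply/esym; apply: (@lebesgue_measure_unique R m) => //= X [[x y] _ <-].
rewrite /pushforward /=.
have -> : (fun z : measurableTypeR R => (z : R) + a) @^-1` `]x, y] =
    `](x - a), (y - a)]%classic.
  by apply/seteqP; split => z /=; rewrite !in_itv/= ltrBlDr lerBrDr.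
rewrite !lebesgue_measure_itv/= !lte_fin ltrD2r.
by case: ifP => // _; rewrite -!EFinB; congr EFin; ring.
Qed.

Lemma coord_le_norm (R : realType) n (v : 'rV[R]_n) i : `|v ord0 i| <= `|v|.
Proof.
rewrite [leRHS]/Num.Def.normr/= mx_normrE.
exact: (le_bigmax _ (fun ij => `|v ij.1 ij.2|) (ord0, i)).
Qed.

Section Lebesgue_rV.
Context {R : realType} {n : nat}.
Local Notation E := 'rV[R]_n.
Local Notation mu := (@lebesgue_rV R n).
Implicit Types (A : 'I_n -> set (measurableTypeR R)) (a : E) (r : R).

Definition boxset A : set E := [set v | forall i, A i (v ord0 i)].

Definition cube a r : set E := [set v | forall i, `|v ord0 i - a ord0 i| <= r].

Definition ocube a r : set E := [set v | forall i, `|v ord0 i - a ord0 i| < r].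

Lemma measurable_boxset A : (forall i, measurable (A i)) ->
  measurable (boxset A).
Proof.
move=> mA; rewrite (_ : boxset A = \big[setI/setT]_(i < n)
  (rV_coord i @^-1` A i)).
  apply: bigsetI_measurable => i _.
  by rewrite -[X in measurable X]setTI; exact: measurable_rV_coord.
rewrite -bigcap_seq; apply/seteqP; split => [v Av i _|v Av i]; first exact: Av.
by apply: Av; rewrite /= mem_index_enum.
Qed.

Lemma cubeE a r :
  cube a r = boxset (fun i => `[a ord0 i - r, a ord0 i + r]%classic).
Proof.
by apply/seteqP; split => v h i; have := h i; rewrite /= in_itv/= ler_distl.
Qed.

Lemma ocubeE a r :
  ocube a r = boxset (fun i => `]a ord0 i - r, a ord0 i + r[%classic).
Proof.
by apply/seteqP; split => v h i; have := h i; rewrite /= in_itv/= ltr_distl.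
Qed.

Lemma measurable_cube a r : measurable (cube a r).
Proof. by rewrite cubeE; apply: measurable_boxset. Qed.

Lemma measurable_ocube a r : measurable (ocube a r).
Proof. by rewrite ocubeE; apply: measurable_boxset. Qed.

Lemma cube_fin a r : (mu (cube a r) < +oo)%E.
Proof.
rewrite cubeE lebesgue_rV_box//.
under eq_bigr => i _ do rewrite lebesgue_measure_itv/= lte_fin.
rewrite (eq_bigr (fun i => (if a ord0 i - r < a ord0 i + r
    then a ord0 i + r - (a ord0 i - r) else 0)%:E)).
  by rewrite prodEFin ltry.
by move=> i _; case: ifP.
Qed.

Lemma ocube_gt0 a r : 0 < r -> (0 < mu (ocube a r))%E.
Proof.
move=> r0; rewrite ocubeE lebesgue_rV_box//.
under eq_bigr => i _ do rewrite lebesgue_measure_itv/= lte_fin.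
rewrite (eq_bigr (fun i => (r *+ 2)%:E)).
  by rewrite prodEFin lte_fin prodr_gt0// => i _; rewrite mulrn_wgt0.
move=> i _; rewrite ifT; first by rewrite -EFinB; congr EFin; ring.
by lra.
Qed.

Lemma open_ocube (U : set E) x : open U -> U x ->
  exists2 r, 0 < r & ocube x r `<=` U.
Proof.
move=> oU Ux; have /nbhs_ballP [e /= e0 eU] : nbhs x U by exact: open_nbhs_nbhs.
exists e => // y xy; apply: eU; split => // i j.
by rewrite (ord1 i) /ball/= distrC; exact: xy.
Qed.

(** The sigma-algebra is generated by coordinates, so openness has to be reduced to countably many
    boxes: [U] is the union of the cubes with rational centre and radius 1/(k+1) that it
    contains. *)
Lemma open_measurable_rV (U : set E) : open U -> measurable U.
Proof.
move=> oU.
pose B (qk : 'rV[rat]_n * nat) := ocube (map_mx ratr qk.1) (qk.2.+1%:R^-1).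
pose F qk := if `[< B qk `<=` U >] then B qk else set0.
have -> : U = \bigcup_qk F qk.
  apply/seteqP; split => [x Ux|x [qk _]]; last first.
    by rewrite /F; case: asboolP => // h; exact: h.
  have [r r0 rU] := open_ocube oU Ux.
  (* Half of [r], because the rational centre is within 1/(k+1) of [x] and the points of the cube
     are within 1/(k+1) of that centre. *)
  have [k _ kr] : exists2 k, True & k.+1%:R^-1 < r / 2.
    exists (Num.truncn (2 / r)) => //.
    have : 2 / r < (Num.truncn (2 / r)).+1%:R by rewrite truncnS_gt.
    rewrite -ltf_pV2 ?posrE// ?divr_gt0// => /lt_le_trans; apply.
    by rewrite invf_div.
  have k0 : 0 < k.+1%:R^-1 :> R by rewrite invr_gt0.
  have /choice[q qP] : forall i : 'I_n, exists q : rat,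
      `|x ord0 i - ratr q| < k.+1%:R^-1.
    move=> i; have /rat_in_itvoo[q] : x ord0 i - k.+1%:R^-1 < x ord0 i + k.+1%:R^-1.
      by rewrite ltrBlDr -addrA ltrDl addr_gt0.
    by rewrite in_itv/= -ltr_distl distrC => qx; exists q.
  exists (\row_i q i, k) => //; rewrite /F asboolT.
    by move=> i; rewrite !mxE; exact: qP.
  move=> y yB; apply: rU => i.
  have := yB i; have := qP i; rewrite !mxE /=; move: k0 kr.
  set e := _^-1 => k0 kr; rewrite !ltr_distl => /andP[? ?] /andP[? ?].
  by apply/andP; split; lra.
apply: countable_bigcupT_measurable; first exact: countableP.
by move=> qk; rewrite /F; case: asboolP => _ //; exact: measurable_ocube.
Qed.

Lemma open_continuous_measurable_rV (U : set E) (f : E -> R) : open U ->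
  (forall x, U x -> {for x, continuous f}) -> measurable_fun U f.
Proof.
move=> oU cf; apply: (measurability _ (RGenOpens.measurableE R)).
move=> _ [_ [a [b ->] <-]]; apply: open_measurable_rV.
rewrite openE => x [Ux fx]; apply: filterI; first exact: open_nbhs_nbhs.
by apply: cf => //; apply: open_nbhs_nbhs; split => //; exact: interval_open.
Qed.

Lemma measurable_shift a : measurable_fun [set: E] (fun x : E => x + a).
Proof.
apply: measurable_fun_rVP => i.
rewrite (_ : _ \o _ = (fun x : E => (rV_coord i x : R) + a ord0 i)); last first.
  by apply/funext => x /=; rewrite /rV_coord mxE.
by apply: measurable_funD => //; exact: measurable_rV_coord.
Qed.

(** Uniqueness of measures requires a generating family stable under intersection. Boxes form one;
    the one-coordinate cylinders that define the sigma-algebra in general do not. *)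
Lemma measurable_boxsetE : @measurable _ E =
  <<s [set B | exists2 A, (forall i, measurable (A i)) & B = boxset A] >>.
Proof.
apply/seteqP; split.
  apply: smallest_sub; first exact: smallest_sigma_algebra.
  rewrite -bigcup_seq => _ [i _ [Y mY <-]].
  apply: sub_sigma_algebra => /=.
  exists (fun j => if j == i then Y else setT); first by move=> j; case: ifP.
  rewrite setTI; apply/seteqP; split => [v vY j|v /(_ i)]; last by rewrite eqxx.
  by case: ifP => [/eqP->|].
apply: smallest_sub; first exact: sigma_algebra_measurable.
by move=> _ [A mA ->]; exact: measurable_boxset.
Qed.

Lemma lebesgue_rV_shift a (B : set E) : measurable B ->
  mu ((fun x : E => x + a) @^-1` B) = mu B.
Proof.
pose m := measure_function_pushforward__canonical__measure_function_Measure
  mu (measurable_shift a).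
move=> mB; apply/esym.
apply: (measure_unique _ (fun k : nat => cube 0 k%:R) measurable_boxsetE _ _ _
  mu m) mB.
- move=> _ _ [A mA ->] [A' mA' ->]; exists (fun i => A i `&` A' i).
    by move=> i; exact: measurableI.
  apply/seteqP; split => [v [h h'] i|v h]; first by split.
  by split => i; case: (h i).
- by move=> k; exists (fun i => `[(0 : E) ord0 i - k%:R, (0 : E) ord0 i + k%:R]%classic);
    [move=> i|exact: cubeE].
- apply/seteqP; split => // v _.
  exists (Num.truncn `|v|).+1 => // i; rewrite mxE subr0.
  apply: (@le_trans _ _ `|v|); last by apply/ltW; rewrite truncnS_gt.
  exact: coord_le_norm.
- move=> _ [A mA ->]; rewrite /m/= /pushforward.
  rewrite (_ : _ @^-1` _ = boxset (fun i =>
      (fun x : measurableTypeR R => (x : R) + a ord0 i) @^-1` A i)); last first.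
    by apply/seteqP; split => v h i; have := h i; rewrite /= mxE.
  rewrite !lebesgue_rV_box//.
    by apply: eq_bigr => i _; rewrite lebesgue_measure_shift.
  move=> i; rewrite -[X in measurable X]setTI.
  have mf : measurable_fun [set: measurableTypeR R]
      ((fun x => (x : R) + a ord0 i) : measurableTypeR R -> measurableTypeR R).
    by apply: measurable_funD => //; exact: measurable_id.
  exact: mf.
- by move=> k; exact: cube_fin.
Qed.

End Lebesgue_rV.

(** * Integration by parts and Fubini for functions vanishing off a cube *)

(** Both difference quotients are the same function of the increment. This transfers the mean value
    theorem and the chain rule from one variable to directional derivatives. *)
Lemma is_derive_lineP (R : realType) n (f : 'rV[R]_n -> R) (x v : 'rV[R]_n)
    (t d : R) :
  is_derive t 1 (fun s => f (s *: v + x)) d <-> is_derive (t *: v + x) v f d.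
Proof.
have e : (fun h : R => h^-1 *: (((fun s => f (s *: v + x)) \o shift t) (h *: 1)
      - f (t *: v + x))) =
    (fun h : R => h^-1 *: ((f \o shift (t *: v + x)) (h *: v) - f (t *: v + x))).
  apply/funext => h /=; congr (_ *: (f _ - _)).
  by rewrite [h *: 1]mulr1 scalerDl addrA.
by split => -[h1 h2]; split; rewrite /derivable /derive in h1 h2 *;
  rewrite ?e in h1 h2 *.
Qed.

Lemma is_derive1_continuous (R : realType) (f : R -> R) (x d : R) :
  is_derive x 1 f d -> {for x, continuous f}.
Proof.
by move=> [fx _]; apply: differentiable_continuous; exact/derivable1_diffP.
Qed.

Lemma directional_MVT (R : realType) n (f f' : 'rV[R]_n -> R) (v : 'rV[R]_n)
    (S : R) : (forall x, is_derive x v f (f' x)) -> (forall x, `|f' x| <= S) ->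
  forall (x : 'rV[R]_n) (h : R), 0 <= h -> `|f (h *: v + x) - f x| <= S * h.
Proof.
move=> ff' f'S x h h0.
have df (t : R) : is_derive t 1 (fun s : R => f (s *: v + x)) (f' (t *: v + x)).
  exact/is_derive_lineP.
have cf : continuous (fun s : R => f (s *: v + x)).
  by move=> t; exact: is_derive1_continuous (df t).
have [|t _ /=] := MVT_segment h0 (fun t _ => df t).
  exact: continuous_subspaceT.
rewrite scale0r add0r subr0 => ->.
by rewrite normrM (ger0_norm h0) ler_wpM2r.
Qed.

Section integration.
Context {R : realType} {n : nat}.
Local Notation E := 'rV[R]_n.
Local Notation mu := (@lebesgue_rV R n).
Implicit Types (f g : E -> R) (a : E).

(** Membership gives integrability, and the class is stable under translation, sums and products
    with bounded measurable functions, so that integrals can be handled as real numbers. *)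
Definition bounded_in_cube a (r S : R) g :=
  [/\ measurable_fun [set: E] g, forall x, `|g x| <= S &
      forall x, ~ cube a r x -> g x = 0].

Lemma bounded_in_cube_integrable a r S g : bounded_in_cube a r S g ->
  mu.-integrable [set: E] (EFin \o g).
Proof.
move=> [mg gS g0]; have -> : EFin \o g = (EFin \o g) \_ (cube a r).
  apply/funext => x; rewrite patchE; case: ifPn => // /negP.
  by rewrite inE /= => /g0 ->.
have mc := measurable_cube a r; apply: (iffLR (@integrable_mkcond _ _ _ mu _ _ mc)).
apply: measurable_bounded_integrable => //.
- exact: cube_fin.
- exact: measurable_funTS.
- exists S; split; first exact: num_real.
  by move=> M SM x _; exact: le_trans (gS x) (ltW SM).
Qed.

Lemma Rintegral_bound_cube a r S g : bounded_in_cube a r S g ->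
  `|\int[mu]_x g x| <= S * fine (mu (cube a r)).
Proof.
move=> gb; have ig := bounded_in_cube_integrable gb; have [mg gS g0] := gb.
have mc := measurable_cube a r.
have S0 : 0 <= S by rewrite (le_trans _ (gS a)).
apply: (le_trans (le_normr_Rintegral _ ig)) => //.
have -> : S * fine (mu (cube a r)) = \int[mu]_x ((cst S) \_ (cube a r)) x.
  by rewrite -Rintegral_mkcond Rintegral_cst.
apply: le_Rintegral => //.
- by apply: integrable_norm.
- apply: (@bounded_in_cube_integrable a r S); split.
  + by apply/(measurable_restrictT _ mc).
  + by move=> x; rewrite patchE; case: ifP => _; rewrite ?normr0// ger0_norm.
  + by move=> x; rewrite patchE; case: ifPn => // /[!inE].
- move=> x _; rewrite patchE; case: ifPn => [_|/negP]; first exact: gS.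
  by rewrite inE => /g0 ->; rewrite normr0.
Qed.

Lemma cubeD a b r (x : E) : cube a r (x + b) = cube (a - b) r x.
Proof.
by apply/propext; split => h i; have := h i; rewrite !mxE opprB addrA addrAC.
Qed.

Lemma bounded_in_cube_shift a r S g b : bounded_in_cube a r S g ->
  bounded_in_cube (a - b) r S (fun x => g (x + b)).
Proof.
move=> [mg gS g0]; split => //.
- by apply: (measurableT_comp mg); exact: measurable_shift.
- by move=> x; rewrite -cubeD => /g0.
Qed.

Lemma Rintegral_shift a r S g b : bounded_in_cube a r S g ->
  \int[mu]_x g (x + b) = \int[mu]_x g x.
Proof.
move=> gb; have [mg _ _] := gb; congr fine.
have mEg : measurable_fun [set: E] (EFin \o g) by exact/measurable_EFinP.
have ig := bounded_in_cube_integrable (bounded_in_cube_shift b gb).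
have := @integral_pushforward _ _ _ _ _ _ (measurable_shift b) mu setT
  (EFin \o g) mEg.
rewrite preimage_setT => /(_ ig measurableT) <-.
apply: eq_measure_integral; first exact: measurable_shift.
move=> ? A mA _; rewrite /= /pushforward.
exact: lebesgue_rV_shift.
Qed.

Lemma bounded_in_cubeW a r S g r' S' : r <= r' -> S <= S' ->
  bounded_in_cube a r S g -> bounded_in_cube a r' S' g.
Proof.
move=> rr' SS' [mg gS g0]; split => //; first by move=> x; exact: le_trans SS'.
move=> x xr; apply: g0; apply: contra_not xr => h i.
exact: le_trans (h i) rr'.
Qed.

Lemma bounded_in_cubeZ a r S g k : bounded_in_cube a r S g ->
  bounded_in_cube a r (`|k| * S) (fun x => k * g x).
Proof.
move=> [mg gS g0]; split; first exact: measurable_funM.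
- by move=> x; rewrite normrM ler_wpM2l.
- by move=> x /g0 ->; rewrite mulr0.
Qed.

Lemma bounded_in_cubeD a r S S' f g : bounded_in_cube a r S f ->
  bounded_in_cube a r S' g -> bounded_in_cube a r (S + S') (fun x => f x + g x).
Proof.
move=> [mf fS f0] [mg gS g0]; split; first exact: measurable_funD.
- by move=> x; rewrite (le_trans (ler_normD _ _))// lerD.
- by move=> x xc; rewrite f0// g0// addr0.
Qed.

Lemma bounded_in_cubeMr a r S S' f g : bounded_in_cube a r S f ->
  measurable_fun [set: E] g -> (forall x, `|g x| <= S') ->
  bounded_in_cube a r (S * S') (fun x => f x * g x).
Proof.
move=> [mf fS f0] mg gS; split; first exact: measurable_funM.
- by move=> x; rewrite normrM ler_pM.
- by move=> x xc; rewrite f0// mul0r.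
Qed.

(* By translation invariance the difference quotients have integral 0. *)
Lemma Rintegral_derive0 a r S S' (f f' : E -> R) (v : E) :
  bounded_in_cube a r S f -> (forall x, is_derive x v f (f' x)) ->
  (forall x, `|f' x| <= S') -> \int[mu]_x f' x = 0.
Proof.
move=> fb ff' f'S; have [mf fS f0] := fb.
pose h : R^nat := harmonic.
have h0 k : 0 < h k by rewrite /h /= invr_gt0.
have h1 k : h k <= 1 by rewrite /h /= invf_le1 // ler1n.
have hd : h @ \oo --> (0 : R)^'.
  move=> A A0; have H : \forall k \near \oo, h k != 0 -> A (h k) := @cvg_harmonic R _ A0.
  apply: filterS H => k /=; apply.
  by rewrite gt_eqF.
pose q k x := (h k)^-1 * (f (x + h k *: v) - f x).
have qE x : q ^~ x @ \oo --> f' x.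
  have [dfx <-] := ff' x; rewrite /q.
  under eq_fun do rewrite (addrC x).
  exact: (cvg_comp _ _ hd dfx).
(* Since [h k <= 1], all the quotients vanish off one cube, enlarged by the norm of [v], and the
   mean value theorem bounds them by [S']. This is the domination needed to pass to the limit. *)
have qb k : bounded_in_cube a (r + `|v|) S' (q k).
  split.
  - apply: measurable_funM => //; apply: measurable_funB => //.
    by apply: (measurableT_comp mf); exact: measurable_shift.
  - move=> x; rewrite normrM gtr0_norm ?invr_gt0// mulrC ler_pdivrMr//.
    by rewrite (addrC x); apply: directional_MVT => //; exact: ltW.
  - move=> x xc; rewrite /q !f0 ?subrr ?mulr0//.
      by apply: contra_not xc => xr i; rewrite (le_trans (xr i))// lerDl.
    apply: contra_not xc => xr i; have := xr i; rewrite !mxE => xri.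
    have vi : `|h k * v ord0 i| <= `|v|.
      rewrite normrM (gtr0_norm (h0 k)); apply: (le_trans _ (coord_le_norm v i)).
      by rewrite ler_piMl.
    have -> : x ord0 i - a ord0 i =
      (x ord0 i + h k * v ord0 i - a ord0 i) - h k * v ord0 i by ring.
    by rewrite (le_trans (ler_normB _ _))// lerD.
have q0 k : \int[mu]_x q k x = 0.
  have ifb := bounded_in_cube_integrable fb.
  have ifs := bounded_in_cube_integrable (bounded_in_cube_shift (h k *: v) fb).
  rewrite RintegralZl//; last exact: (integrableB measurableT ifs ifb).
  by rewrite RintegralB// (Rintegral_shift _ fb) subrr mulr0.
have mq k : measurable_fun [set: E] (q k) by have [] := qb k.
have mf' : measurable_fun [set: E] f'.
  by apply: (measurable_fun_cvg mq) => x _; exact: qE.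
pose G := (cst S') \_ (cube a (r + `|v|)) : E -> R.
have mc := measurable_cube a (r + `|v|).
have S'0 : 0 <= S' by rewrite (le_trans _ (f'S a)).
have Gb : bounded_in_cube a (r + `|v|) S' G.
  split; first by apply/(measurable_restrictT _ mc).
  - by move=> x; rewrite /G patchE; case: ifP => _; rewrite ?normr0// ger0_norm.
  - by move=> x; rewrite /G patchE; case: ifPn => // /[!inE].
have [] := @dominated_convergence _ _ _ mu setT measurableT
  (fun k => EFin \o q k) (EFin \o f') (EFin \o G).
- by move=> k; exact/measurable_EFinP.
- exact/measurable_EFinP.
- by apply: aeW => x _; apply: cvg_EFin; [exact: nearW|exact: qE].
- exact: bounded_in_cube_integrable Gb.
- apply: aeW => x k _ /=; rewrite lee_fin /G patchE; case: ifPn => [_|/negP].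
    by have [_ + _] := qb k; exact.
  by rewrite inE; have [_ _ +] := qb k => /[apply] ->; rewrite normr0.
move=> _ _ cv.
have : (fun k => \int[mu]_x (EFin \o q k) x)%E @ \oo --> 0%E.
  rewrite (_ : (fun k => _) = cst 0%E); first exact: cvg_cst.
  apply/funext => k /=; rewrite -[LHS]fineK; last first.
    exact: (integrable_fin_num measurableT (bounded_in_cube_integrable (qb k))).
  by congr EFin; exact: q0.
by move=> /(cvg_unique _ cv) cv0; rewrite /Rintegral [X in fine X]cv0.
Qed.

Lemma measurable_subrV :
  measurable_fun [set: E * E] (fun xy : E * E => xy.1 - xy.2).
Proof.
apply: measurable_fun_rVP => i.
rewrite (_ : _ \o _ = (fun xy : E * E =>
    (rV_coord i xy.1 : R) - rV_coord i xy.2)); last first.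
  by apply/funext => x /=; rewrite /rV_coord !mxE.
by apply: measurable_funB;
  apply: measurableT_comp => //; exact: measurable_rV_coord.
Qed.

(** * Fubini's theorem for convolutions with a bounded kernel *)

Section convolution.
Variables (a b : E) (r S r' S' k : R) (f g c : E -> R).
Hypotheses (fb : bounded_in_cube a r S f) (gb : bounded_in_cube b r' S' g).
Hypotheses (mc : measurable_fun [set: E] c) (ck : forall x, `|c x| <= k).

Let F (xy : E * E) := f xy.1 * (g xy.2 * c (xy.1 - xy.2)).

Let k0 : 0 <= k.
Proof. exact: le_trans (ck a). Qed.

Let iF : (mu \x mu)%E.-integrable [set: E * E] (EFin \o F).
Proof.
have [mf fS f0] := fb; have [mg gS g0] := gb.
have mF : measurable_fun [set: E * E] F.
  apply: measurable_funM; first exact: measurableT_comp.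
  apply: measurable_funM; first exact: measurableT_comp.
  exact: (measurableT_comp mc measurable_subrV).
have S0 : 0 <= S by rewrite (le_trans _ (fS a)).
have S'0 : 0 <= S' by rewrite (le_trans _ (gS a)).
pose K := cube a r `*` cube b r'.
have mK : measurable K by apply: measurableX; exact: measurable_cube.
have -> : EFin \o F = (EFin \o F) \_ K.
  apply/funext => -[x y]; rewrite patchE; case: ifPn => // /negP.
  rewrite inE /= => xy; rewrite /F/=.
  have [xa|/f0 ->] := pselect (cube a r x); last by rewrite mul0r.
  have [yb|/g0 ->] := pselect (cube b r' y); last by rewrite mul0r mulr0.
  by exfalso; apply: xy.
apply: (iffLR (@integrable_mkcond _ _ _ (mu \x mu)%E _ _ mK)).
apply: (@measurable_bounded_integrable _ _ _ (mu \x mu)%E F K mK) => //.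
- rewrite [X in (X < _)%E](product_measure1E mu mu); [|exact: measurable_cube..].
  apply: lte_mul_pinfty => //; last exact: cube_fin.
  by rewrite ge0_fin_numE//; exact: cube_fin.
- exact: measurable_funTS.
- exists (S * (S' * k)); split; first exact: num_real.
  move=> M SM [x y] _; apply: (le_trans _ (ltW SM)); rewrite /F/=.
  by rewrite !normrM; do 2 (rewrite ler_pM// ?mulr_ge0//).
Qed.

Lemma bounded_in_cube_translate x :
  bounded_in_cube b r' (S' * k) (fun y => g y * c (x - y)).
Proof.
apply: bounded_in_cubeMr => //; apply: (measurableT_comp mc).
exact: (measurableT_comp measurable_subrV (measurable_pair1 x)).
Qed.

Let fcb y : bounded_in_cube a r (S * k) (fun x => f x * c (x - y)).
Proof.
by apply: bounded_in_cubeMr => //; exact: (measurableT_comp mc (measurable_shift _)).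
Qed.

Let inner1 x : (\int[mu]_y (EFin \o F) (x, y))%E =
    (f x * \int[mu]_y (g y * c (x - y)))%:E.
Proof.
have gcb := bounded_in_cube_translate x.
rewrite /F /= -(RintegralZl _ measurableT (bounded_in_cube_integrable gcb)).
rewrite /Rintegral fineK//; apply: (integrable_fin_num measurableT).
exact: (bounded_in_cube_integrable (bounded_in_cubeZ (f x) gcb)).
Qed.

Let inner2 y : (\int[mu]_x (EFin \o F) (x, y))%E =
    (g y * \int[mu]_x (f x * c (x - y)))%:E.
Proof.
rewrite -(RintegralZl _ measurableT (bounded_in_cube_integrable (fcb y))).
rewrite /Rintegral fineK//; last first.
  apply: (integrable_fin_num measurableT).
  exact: (bounded_in_cube_integrable (bounded_in_cubeZ (g y) (fcb y))).
by apply: eq_integral => x _ /=; rewrite /F/= mulrCA.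
Qed.

(** Both sides are iterated integrals of f(x) g(y) c(x - y), which is bounded and vanishes off a
    product of two cubes. *)
Lemma Rintegral_convolution :
  \int[mu]_x (f x * \int[mu]_y (g y * c (x - y))) =
  \int[mu]_y (g y * \int[mu]_x (f x * c (x - y))).
Proof.
have E1 : (\int[mu]_x (f x * \int[mu]_y (g y * c (x - y)))%:E)%E =
    (\int[mu]_x \int[mu]_y (EFin \o F) (x, y))%E.
  by apply: eq_integral => x _; rewrite inner1.
have E2 : (\int[mu]_y (g y * \int[mu]_x (f x * c (x - y)))%:E)%E =
    (\int[mu]_y \int[mu]_x (EFin \o F) (x, y))%E.
  by apply: eq_integral => x _; rewrite inner2.
exact: (congr1 fine (etrans E1 (etrans (Fubini iF) (esym E2)))).
Qed.

Lemma integrable_convolutionl : mu.-integrable [set: E]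
  (EFin \o (fun x => f x * \int[mu]_y (g y * c (x - y)))).
Proof.
have := integrable_fubini_F iF; apply: eq_integrable => // x _.
exact: inner1.
Qed.

End convolution.

Lemma measurable_opprV : measurable_fun [set: E] (fun x : E => - x).
Proof.
apply: measurable_fun_rVP => i.
rewrite (_ : _ \o _ = (fun x : E => - (rV_coord i x : R))); last first.
  by apply/funext => x /=; rewrite /rV_coord !mxE.
by apply: measurable_funN; exact: measurable_rV_coord.
Qed.

Lemma integrable_convolutionr a b r S r' S' k f g (c : E -> R) :
  bounded_in_cube a r S f -> bounded_in_cube b r' S' g ->
  measurable_fun [set: E] c -> (forall x, `|c x| <= k) ->
  mu.-integrable [set: E]
    (EFin \o (fun y => g y * \int[mu]_x (f x * c (x - y)))).
Proof.
move=> fb gb mc ck.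
have mc' : measurable_fun [set: E] (fun x => c (- x)).
  exact: (measurableT_comp mc measurable_opprV).
have := integrable_convolutionl gb fb mc' (fun x => ck (- x)).
apply: eq_integrable => // y _ /=; congr ((_ * _)%:E).
by apply: eq_Rintegral => x _; rewrite opprB.
Qed.

(** A nonnegative function with zero integral vanishes almost everywhere, whereas [U] contains a
    cube of positive measure. *)
Lemma Rintegral_gt0 a r S f (U : set E) x : bounded_in_cube a r S f ->
  (forall y, 0 <= f y) -> open U -> U x -> (forall y, U y -> 0 < f y) ->
  0 < \int[mu]_y f y.
Proof.
move=> fb f0 oU Ux Uf; have [mf fS _] := fb.
rewrite lt_neqAle Rintegral_ge0// andbT eq_sym; apply/eqP => If0.
have [d d0 dU] := open_ocube oU Ux.
have I0 : (\int[mu]_y `|(f y)%:E|)%E = 0%E.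
  under eq_integral do rewrite gee0_abs ?lee_fin//.
  rewrite -[LHS]fineK; first by congr EFin; exact: If0.
  exact: (integrable_fin_num measurableT (bounded_in_cube_integrable fb)).
have /(ae_eq_integral_abs mu measurableT) : measurable_fun setT (EFin \o f).
  exact/measurable_EFinP.
move=> /(iffLR); move=> /(_ I0) [A [mA A0 fA]].
have : (mu (ocube x d) <= mu A)%E.
  apply: le_measure; rewrite ?inE//; first exact: measurable_ocube.
  move=> y /dU /Uf fy; apply: fA => /= /(_ Logic.I) [] fy0.
  by rewrite fy0 ltxx in fy.
by rewrite A0 leNgt ocube_gt0.
Qed.

End integration.

(** * Smooth bumps *)

Lemma cvg_sumr (R : realType) (T : Type) (F : set_system T) (FF : Filter F) m
    (h : 'I_m -> T -> R) (l : 'I_m -> R) :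
  (forall j, h j x @[x --> F] --> l j) ->
  \sum_(j < m) h j x @[x --> F] --> \sum_(j < m) l j.
Proof.
move=> hl; elim: (index_enum _) => [|j s IH].
  by under eq_fun do rewrite big_nil; rewrite big_nil; exact: cvg_cst.
by under eq_fun do rewrite big_cons; rewrite big_cons; exact: cvgD.
Qed.

Section directional_derivatives.
Context {R : realType} {n : nat}.
Local Notation E := 'rV[R]_n.
Implicit Types (x v : E).

Lemma is_derive_comp1 (f : R -> R) (q : E -> R) x v (a b : R) :
  is_derive (q x) 1 f a -> is_derive x v q b ->
  is_derive x v (fun z => f (q z)) (a * b).
Proof.
move=> fa qb; have x0 : x = 0 *: v + x by rewrite scale0r add0r.
rewrite x0; apply/(is_derive_lineP (fun z => f (q z))).
apply: (@is_derive1_comp _ f (fun s : R => q (s *: v + x))).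
  by rewrite -x0.
by apply/is_derive_lineP; rewrite -x0.
Qed.

Lemma is_derive_coord j x v : is_derive x v (fun z : E => z ord0 j) (v ord0 j).
Proof.
have x0 : x = 0 *: v + x by rewrite scale0r add0r.
rewrite x0; apply/(is_derive_lineP (fun z : E => z ord0 j)).
rewrite (_ : (fun s => _) = (fun s : R => s * v ord0 j + x ord0 j)); last first.
  by apply/funext => s; rewrite !mxE.
apply: is_derive_eq.
by rewrite scaler0 add0r addr0 [_ *: _]mulr1.
Qed.

Lemma is_derive_sumr m (h : 'I_m -> E -> R) (dh : 'I_m -> R) x v :
  (forall j, is_derive x v (h j) (dh j)) ->
  is_derive x v (fun z => \sum_(j < m) h j z) (\sum_(j < m) dh j).
Proof.
move=> hd; have := is_derive_sum hd; congr (is_derive _ _ _ _).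
by apply/funext => z; rewrite fct_sumE.
Qed.

Lemma sum_delta (i : 'I_n) (F : 'I_n -> R) :
  \sum_(j < n) F j * (delta_mx ord0 i : E) ord0 j = F i.
Proof.
rewrite (bigD1 i)//= big1 ?addr0 ?mxE ?eqxx ?mulr1// => j ji.
by rewrite mxE (negbTE ji) andbF mulr0.
Qed.

Lemma is_derive_separable (g : 'I_n -> R -> R) (dg : 'I_n -> R) i x :
  (forall j, is_derive (x ord0 j) 1 (g j) (dg j)) ->
  is_derive x (delta_mx ord0 i) (fun z : E => \sum_(j < n) g j (z ord0 j)) (dg i).
Proof.
move=> gd; rewrite -(sum_delta i dg); apply: is_derive_sumr => j.
exact: (is_derive_comp1 (gd j) (is_derive_coord j x _)).
Qed.

End directional_derivatives.

(** Settles differentiability at the gluing point of functions defined by cases, namely [flat_exp k]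
    and the squared positive part. *)
Lemma is_derive_sqr_bound (R : realType) (f : R -> R) (C : R) :
  (forall s, `|f s| <= C * s ^+ 2) -> is_derive (0 : R) 1 f 0.
Proof.
move=> fC; have f0 : f 0 = 0.
  by apply/eqP; rewrite -normr_le0 (le_trans (fC 0))// expr0n mulr0.
have C0 : 0 <= C by have := fC 1; rewrite expr1n mulr1; apply: le_trans.
have cv : (fun h : R => h^-1 *: ((f \o shift 0) (h *: 1) - f 0)) @ 0^' --> (0 : R).
  apply/cvgrPdist_le => e e0; near=> h.
  have h0 : h != 0 by near: h; exact: nbhs_dnbhs_neq.
  rewrite sub0r normrN f0 subr0 /= addr0 [h *: 1]mulr1 normrM normfV.
  rewrite mulrC ler_pdivrMr ?normr_gt0// (le_trans (fC h))//.
  rewrite -real_normK ?num_real// expr2 mulrA ler_wpM2r//.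
  have he : `|h| <= e / (C + 1).
    by near: h; apply: dnbhs0_le; rewrite divr_gt0// ltr_wpDl.
  have C1 : 0 < C + 1 by rewrite ltr_wpDl.
  rewrite (le_trans (ler_wpM2l C0 he))// mulrA ler_pdivrMr//.
  by nra.
by split; [apply/cvg_ex; exists 0|exact: cvg_lim].
Unshelve. all: by end_near. Qed.

Section bump1.
Context {R : realType}.
Implicit Types (k : nat) (s : R).

(** The functions s^(-k) exp(-1/s), extended by 0. The derivative of the one of index k combines
    those of indices k + 2 and k + 1, so the family accounts for all derivatives of exp(-1/s). *)
Definition flat_exp k s : R :=
  if 0 < s then s^-1 ^+ k * expR (- s^-1) else 0.

Lemma flat_exp_ge0 k s : 0 <= flat_exp k s.
Proof.
rewrite /flat_exp; case: ifP => // s0.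
by rewrite mulr_ge0 ?expR_ge0// exprn_ge0// invr_ge0 ltW.
Qed.

(** From exp t >= t^(k+2) / (k+2)! at t = 1/s. The power k + 2 leaves a factor s^2, which is what
    differentiability at 0 requires. *)
Lemma flat_exp_le k s : flat_exp k s <= (k.+2)`!%:R * s ^+ 2.
Proof.
rewrite /flat_exp; case: ifP => s0; last by rewrite mulr_ge0// sqr_ge0.
have si : 0 < s^-1 by rewrite invr_gt0.
have h : s^-1 ^+ k.+2 / (k.+2)`!%:R <= expR s^-1.
  by have := expR_ge1Dxn k.+1 (ltW si); apply: le_trans; rewrite lerDr.
rewrite expRN ler_pdivrMr ?expR_gt0//.
have k0 : 0 < (k.+2)`!%:R :> R by rewrite ltr0n fact_gt0.
move: h; rewrite ler_pdivrMr// => h.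
have -> : s^-1 ^+ k = s ^+ 2 * s^-1 ^+ k.+2.
  rewrite (exprS _ k.+1) (exprS _ k) expr2 !mulrA mulfK ?gt_eqF//.
  by rewrite mulfV ?gt_eqF// mul1r.
rewrite (le_trans (ler_wpM2l (sqr_ge0 s) h))//.
by rewrite le_eqVlt; apply/orP; left; apply/eqP; ring.
Qed.

Lemma flat_exp_norm_le k s : `|flat_exp k s| <= (k.+2)`!%:R * s ^+ 2.
Proof. by rewrite ger0_norm ?flat_exp_ge0// flat_exp_le. Qed.

Lemma is_derive_flat_exp k s :
  is_derive s 1 (flat_exp k) (flat_exp k.+2 s - k%:R * flat_exp k.+1 s).
Proof.
have [s0|s0|->] := ltgtP s 0.
- have -> : flat_exp k.+2 s - k%:R * flat_exp k.+1 s = 0.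
    by rewrite /flat_exp !ltNge (ltW s0)/= mulr0 subr0.
  have d0 : is_derive s 1 (cst (0 : R)) 0 by exact: is_derive_cst.
  apply: (near_eq_is_derive _ d0).
  near=> t; rewrite /flat_exp ifF//; apply/negbTE; rewrite -leNgt ltW//.
  by near: t; exact: lt_nbhsl.
- have sn0 : s != 0 by rewrite gt_eqF.
  have dinv : is_derive s 1 (fun t : R => t^-1) (- s ^- 2).
    apply: is_derive_eq; first exact: (is_deriveV sn0 (is_derive_id s 1)).
    by rewrite [_ *: _]mulr1.
  have dex : is_derive s 1 (fun t : R => expR (- t^-1)) (expR (- s^-1) * s ^- 2).
    have := @is_derive1_comp R expR (fun t => - t^-1) s _ _ (is_derive_expR _)
      (is_deriveN dinv).
    by rewrite opprK.
  have dd : is_derive s 1 (fun t : R => t^-1 ^+ k * expR (- t^-1))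
      (flat_exp k.+2 s - k%:R * flat_exp k.+1 s).
    have := is_deriveM (is_deriveX k dinv) dex.
    rewrite /flat_exp s0 /GRing.scale/= -!exprVn.
    congr (is_derive _ _ _ _); first by apply/funext => t; rewrite !fctE.
    set a := s^-1; set b := expR _.
    have -> : ([eta GRing.inv] ^+ k : R -> R) s = a ^+ k by rewrite fctE.
    case: k => [|k] /=; first by ring.
    rewrite !exprS; set c := k.+1%:R; set e := a ^+ k; ring.
  apply: (near_eq_is_derive _ dd); near=> t; rewrite /flat_exp ifT//.
  by near: t; exact: lt_nbhsr.
- have -> : flat_exp k.+2 (0 : R) - k%:R * flat_exp k.+1 0 = 0.
    by rewrite /flat_exp ltxx mulr0 subr0.
  exact: (is_derive_sqr_bound (flat_exp_norm_le k)).
Unshelve. all: by end_near. Qed.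

Lemma continuous_flat_exp k : continuous (flat_exp k).
Proof. by move=> s; exact: is_derive1_continuous (is_derive_flat_exp k s). Qed.

End bump1.

Lemma is_derive_sqrB (R : realType) (c t : R) :
  is_derive t 1 (fun s => (s - c) ^+ 2) (2 * (t - c)).
Proof.
rewrite (_ : (fun s => _) = (id - cst c) * (id - cst c)); last first.
  by apply/funext => s; rewrite expr2.
apply: is_derive_eq; rewrite /GRing.scale/= !fctE subr0; ring.
Qed.

Section smooth_bump.
Context {R : realType} {n : nat}.
Local Notation E := 'rV[R]_n.
Implicit Types (eps : R) (x y : E) (f : E -> R).

(** For eps > 0 it is positive exactly on the open Euclidean ball of radius eps about y. Composed
    with [flat_exp 0] it gives the standard mollifier exp(-1/(eps^2 - |x - y|^2)), not
    normalised. *)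
Definition paraboloid eps y x : R :=
  eps ^+ 2 - \sum_(i < n) (x ord0 i - y ord0 i) ^+ 2.

(* An algebra of functions containing the bump and stable under partial
   derivatives, so that its elements are of class C^k for all k. *)
Inductive bump_alg eps y : (E -> R) -> Prop :=
| bump_alg_cst c : bump_alg eps y (fun=> c)
| bump_alg_coord i : bump_alg eps y (fun x => x ord0 i)
| bump_alg_flat k : bump_alg eps y (fun x => flat_exp k (paraboloid eps y x))
| bump_alg_add f g : bump_alg eps y f -> bump_alg eps y g ->
    bump_alg eps y (fun x => f x + g x)
| bump_alg_mul f g : bump_alg eps y f -> bump_alg eps y g ->
    bump_alg eps y (fun x => f x * g x).

Lemma continuous_paraboloid eps y : continuous (paraboloid eps y).
Proof.
move=> x; apply: (@continuousB _ _ _ (cst (eps ^+ 2))); first exact: cst_continuous.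
apply: (@cvg_sumr _ _ _ (nbhs_filter x) _
  (fun i (x : E) => (x ord0 i - y ord0 i) ^+ 2)) => i.
apply: (@continuous_comp _ _ _ (fun x : E => x ord0 i - y ord0 i) (fun t => t ^+ 2)).
  exact: (cvgB (@coord_continuous R 1 n ord0 i x) (cvg_cst _)).
exact: exprn_continuous.
Qed.

Lemma is_derive_paraboloid eps y i x : is_derive x (delta_mx ord0 i)
  (paraboloid eps y) (- 2 * (x ord0 i - y ord0 i)).
Proof.
have := @is_deriveB _ _ _ (cst (eps ^+ 2))
  (fun z : E => \sum_(j < n) (z ord0 j - y ord0 j) ^+ 2) x (delta_mx ord0 i) _ _
  (is_derive_cst _ _ _)
  (@is_derive_separable _ _ (fun j t => (t - y ord0 j) ^+ 2)
    (fun j => 2 * (x ord0 j - y ord0 j)) i x _).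
rewrite sub0r mulNr; apply => j; exact: is_derive_sqrB.
Qed.

Lemma continuous_bump_alg eps y f : bump_alg eps y f -> continuous f.
Proof.
elim=> {f} [c|i|k|f g _ cf _ cg|f g _ cf _ cg] x.
- exact: cst_continuous.
- exact: coord_continuous.
- apply: (@continuous_comp _ _ _ (paraboloid eps y) (flat_exp k)).
    exact: continuous_paraboloid.
  exact: continuous_flat_exp.
- exact: (cvgD (cf x) (cg x)).
- exact: (cvgM (cf x) (cg x)).
Qed.

Lemma bump_alg_derive eps y f i : bump_alg eps y f ->
  exists2 f', bump_alg eps y f' & forall x, is_derive x (delta_mx ord0 i) f (f' x).
Proof.
elim=> {f} [c|j|k|f g fS [f' f'S df] gS [g' g'S dg]|f g fS [f' f'S df] gS [g' g'S dg]].
- by exists (fun=> 0); [exact: bump_alg_cst|move=> x; exact: is_derive_cst].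
- exists (fun=> (delta_mx ord0 i : E) ord0 j); first exact: bump_alg_cst.
  by move=> x; exact: is_derive_coord.
- exists (fun x => (flat_exp k.+2 (paraboloid eps y x) +
      (- k%:R) * flat_exp k.+1 (paraboloid eps y x)) *
      (- 2 * (x ord0 i + - y ord0 i))).
    by do !(apply: bump_alg_mul || apply: bump_alg_add ||
      apply: bump_alg_flat || apply: bump_alg_coord || apply: bump_alg_cst).
  move=> x; rewrite mulNr; apply: is_derive_comp1; first exact: is_derive_flat_exp.
  exact: is_derive_paraboloid.
- exists (fun x => f' x + g' x); first exact: bump_alg_add.
  by move=> x; exact: (is_deriveD (df x) (dg x)).
- exists (fun x => f x * g' x + g x * f' x).
    by apply: bump_alg_add; apply: bump_alg_mul.
  by move=> x; exact: (is_deriveM (df x) (dg x)).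
Qed.

Lemma bump_alg_Ck eps y f k : bump_alg eps y f -> Ck k [set: E] f.
Proof.
elim: k f => [|k IH] f fS.
  by apply: continuous_subspaceT; exact: continuous_bump_alg fS.
split; first by apply: continuous_subspaceT; exact: continuous_bump_alg fS.
move=> i; have [f' f'S df] := bump_alg_derive i fS; split.
  by move=> x _; exact: ex_derive.
have -> : partial i f = f' by apply/funext => x; exact: derive_val.
exact: IH.
Qed.

Definition smooth_bump eps y x : R := flat_exp 0 (paraboloid eps y x).

(** Only index 2 appears: in the derivative of [flat_exp k] the term of index k + 1 carries the
    factor k, which is 0 here. *)
Definition dbump i eps y x : R :=
  flat_exp 2 (paraboloid eps y x) * (- 2 * (x ord0 i - y ord0 i)).

Lemma is_derive_bump i eps y x :
  is_derive x (delta_mx ord0 i) (smooth_bump eps y) (dbump i eps y x).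
Proof.
apply: is_derive_comp1; last exact: is_derive_paraboloid.
by have := is_derive_flat_exp 0 (paraboloid eps y x); rewrite mul0r subr0.
Qed.

Lemma paraboloid_gt0 eps y x : 0 < eps -> 0 < paraboloid eps y x -> cube y eps x.
Proof.
move=> e0; rewrite /paraboloid subr_gt0 => h i.
rewrite -(@ler_pXn2r _ 2)// ?nnegrE ?ltW// real_normK ?num_real//.
apply: (le_lt_trans _ h); rewrite (bigD1 i)//= lerDl.
by apply: sumr_ge0 => j _; exact: sqr_ge0.
Qed.

Lemma bump_support eps y x : 0 < eps -> ~ cube y eps x -> smooth_bump eps y x = 0.
Proof.
move=> e0 /(contra_not (paraboloid_gt0 e0))/negP/negbTE h.
by rewrite /smooth_bump /flat_exp h.
Qed.

Lemma bump_ge0 eps y x : 0 <= smooth_bump eps y x.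
Proof. exact: flat_exp_ge0. Qed.

Lemma compact_cube y r : compact (cube y r).
Proof. by rewrite cubeE; apply: rV_compact => i; exact: segment_compact. Qed.

Lemma closed_cube y r : closed (cube y r).
Proof. by apply: compact_closed; [exact: norm_hausdorff|exact: compact_cube]. Qed.

Lemma bump_test_function eps y (Omega : set E) : 0 < eps ->
  cube y eps `<=` Omega -> test_function Omega (smooth_bump eps y).
Proof.
move=> e0 yO; have sub : closure [set x | smooth_bump eps y x != 0] `<=` cube y eps.
  rewrite [X in _ `<=` X](iffLR (closure_id _) (@closed_cube y eps)).
  apply: closure_subset => x /= h; apply: contrapT => /(bump_support e0) bx.
  by rewrite bx eqxx in h.
split.
- by move=> k; apply: (@bump_alg_Ck eps y); exact: bump_alg_flat.
- exact: (subclosed_compact (@closed_closure _ _) (compact_cube (y := y) (r := eps)) sub).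
- exact: subset_trans sub yO.
Qed.

Lemma smooth_bump_shift eps y x : smooth_bump eps y x = smooth_bump eps 0 (x - y).
Proof.
by rewrite /smooth_bump /paraboloid; congr (flat_exp _ (_ - _)); apply: eq_bigr => i _;
  rewrite !mxE subr0.
Qed.

Lemma dbump_shift i eps y x : dbump i eps y x = dbump i eps 0 (x - y).
Proof.
rewrite /dbump /paraboloid !mxE subr0; congr (flat_exp _ (_ - _) * _).
by apply: eq_bigr => j _; rewrite !mxE subr0.
Qed.

Lemma smooth_bump_sym eps x y : smooth_bump eps 0 (x - y) = smooth_bump eps 0 (y - x).
Proof.
rewrite /smooth_bump /paraboloid; congr (flat_exp _ (_ - _)).
by apply: eq_bigr => i _; rewrite !mxE !subr0 -sqrrN opprB.
Qed.

Lemma paraboloid_le eps y x : paraboloid eps y x <= eps ^+ 2.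
Proof. by rewrite gerBl sumr_ge0// => i _; exact: sqr_ge0. Qed.

Lemma flat_exp_paraboloid_le k eps y x :
  flat_exp k (paraboloid eps y x) <= (k.+2)`!%:R * eps ^+ 4.
Proof.
have [p0|p0] := ltP 0 (paraboloid eps y x); last first.
  by rewrite /flat_exp ltNge p0/= mulr_ge0// (exprM _ 2 2) sqr_ge0.
rewrite (le_trans (flat_exp_le _ _))// ler_wpM2l// (exprM _ 2 2).
by rewrite ler_pXn2r ?nnegrE ?sqr_ge0 ?(ltW p0)// paraboloid_le.
Qed.

Lemma bounded_in_cube_bump eps y : 0 < eps ->
  bounded_in_cube y eps ((2)`!%:R * eps ^+ 4) (smooth_bump eps y).
Proof.
move=> e0; split.
- apply: (open_continuous_measurable_rV openT) => x _.
  by apply: (@continuous_bump_alg eps y); exact: bump_alg_flat.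
- by move=> x; rewrite ger0_norm ?bump_ge0// flat_exp_paraboloid_le.
- by move=> x; exact: bump_support.
Qed.

Lemma bounded_in_cube_dbump i eps y : 0 < eps ->
  bounded_in_cube y eps ((4)`!%:R * eps ^+ 4 * (2 * eps)) (dbump i eps y).
Proof.
move=> e0; have z x : ~ cube y eps x -> dbump i eps y x = 0.
  move=> /(contra_not (paraboloid_gt0 e0))/negP/negbTE h.
  by rewrite /dbump /flat_exp h mul0r.
split => //.
- apply: (open_continuous_measurable_rV openT) => x _.
  apply: (@continuous_bump_alg eps y).
  by do !(apply: bump_alg_mul || apply: bump_alg_add ||
      apply: bump_alg_flat || apply: bump_alg_coord || apply: bump_alg_cst).
- move=> x; have [h|/z ->] := pselect (cube y eps x); last first.
    by rewrite normr0 !mulr_ge0 ?exprn_ge0// ltW.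
  rewrite /dbump normrM ger0_norm ?flat_exp_ge0//.
  rewrite ler_pM ?flat_exp_ge0//; first exact: flat_exp_paraboloid_le.
  by rewrite normrM normrN (ger0_norm (ler0n R 2)) ler_wpM2l.
Qed.

End smooth_bump.

(** * C^1 test functions *)

Section density.
Context {R : realType} {n : nat}.
Local Notation E := 'rV[R]_n.
Local Notation mu := (@lebesgue_rV R n).
Implicit Types (f g : E -> R) (a b x y : E) (r S eps w : R).

(** A form of the Heine-Cantor theorem. Compactness handles the pairs with a point in the cube, in
    either position; for the other pairs both values are 0. *)
Lemma cube_uniformly_continuous a r g : continuous g ->
  (forall x, ~ cube a r x -> g x = 0) -> forall w, 0 < w ->
  \forall eps \near 0^'+, forall x y, cube x eps y -> `|g x - g y| <= w.
Proof.
move=> cg g0 w w0.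
have /compact_near_coveringP /(_ R (0^'+)
  (fun eps x => forall y, cube x eps y -> `|g x - g y| <= w) _) K : compact (cube a r).
  exact: compact_cube.
have /K {}K : forall x, cube a r x -> \forall x' \near x & eps \near 0^'+,
    forall y, cube x' eps y -> `|g x' - g y| <= w.
  have w2 : 0 < w / 2 by rewrite divr_gt0.
  move=> x _; have /cvgrPdist_lt /(_ _ w2) /nbhs_ballP[d /= d0 dg] := cg x.
  have d2 : 0 < d / 2 by rewrite divr_gt0.
  near=> x' eps => y x'y.
  have [_ xx'] : ball x (d / 2) x' by near: x'; exact: nbhsx_ballx.
  have ed : eps < d / 2 by near: eps; exact: nbhs_right_lt.
  have xd (z : E) : (forall j, `|x ord0 j - z ord0 j| < d) -> `|g x - g z| < w / 2.
    by move=> xz; apply: dg; split => // i j; rewrite (ord1 i); exact: xz.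
  have gx' : `|g x - g x'| < w / 2.
    apply: xd => j; apply: (lt_le_trans (xx' ord0 j)).
    by move: d0; lra.
  have gy : `|g x - g y| < w / 2.
    apply: xd => j.
    have -> : x ord0 j - y ord0 j =
      (x ord0 j - x' ord0 j) - (y ord0 j - x' ord0 j) by ring.
    rewrite (le_lt_trans (ler_normB _ _))// [d]splitr ltrD//; first exact: xx'.
    exact: le_lt_trans (x'y j) ed.
  have -> : g x' - g y = (g x - g y) - (g x - g x') by ring.
  by rewrite (le_trans (ler_normB _ _))// [w]splitr lerD ?ltW.
near=> eps => x y xy.
have sub : cube a r `<=` fun x => forall y, cube x eps y -> `|g x - g y| <= w.
  by near: eps.
have [xa|xa] := pselect (cube a r x); first exact: (sub x).
have [ya|ya] := pselect (cube a r y).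
  by rewrite distrC; apply: (sub y) => // i; rewrite distrC.
by rewrite !g0// subrr normr0 ltW.
Unshelve. all: by end_near. Qed.

Section mollification.
Variables (a b : E) (r r' S S' eps w : R) (f g : E -> R).
Hypotheses (eps0 : 0 < eps).
Hypotheses (fb : bounded_in_cube a r S f) (gb : bounded_in_cube b r' S' g).
Hypotheses (gw : forall x y, cube x eps y -> `|g x - g y| <= w).

Let c := smooth_bump eps (0 : E).
Let J := \int[mu]_x c x.

Let mc : measurable_fun [set: E] c.
Proof. by have [] := bounded_in_cube_bump (0 : E) eps0. Qed.

Let cle x : `|c x| <= 2`!%:R * eps ^+ 4.
Proof. by have [] := bounded_in_cube_bump (0 : E) eps0. Qed.

Lemma Rintegral_bump_gt0 : 0 < J.
Proof.
pose U := paraboloid eps (0 : E) @^-1` [set t | 0 < t].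
have oU : open U.
  apply: open_comp => [x _|]; first exact: continuous_paraboloid.
  exact: open_gt.
apply: (Rintegral_gt0 (bounded_in_cube_bump (0 : E) eps0) _ oU (x := 0)).
- exact: bump_ge0.
- rewrite /U/= /paraboloid big1 ?subr0 ?exprn_gt0// => i _.
  by rewrite subrr expr0n.
- move=> y; rewrite /U/= /smooth_bump /flat_exp => ->.
  by rewrite expr0 mul1r expR_gt0.
Qed.

(** By Fubini's theorem the first integral is that of [f] against the convolution of [g] with [c].
    At [x] this convolution differs from [J * g x] by the integral of (g y - g x) c(x - y), which is
    at most [w * J] in absolute value, because c(x - y) vanishes unless [y] is within [eps] of [x].
    The factor [J] is the mass of the bump, which is not normalised to 1. *)
Lemma mollification_error :
  `|\int[mu]_y (g y * \int[mu]_x (f x * c (x - y))) -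
    J * \int[mu]_x (f x * g x)| <= S * (w * J) * fine (mu (cube a r)).
Proof.
have [mg gS _] := gb; have [mf fS f0] := fb.
rewrite -(Rintegral_convolution fb gb mc cle).
have ifg : mu.-integrable [set: E] (EFin \o (fun x => f x * g x)).
  exact: bounded_in_cube_integrable (bounded_in_cubeMr fb mg gS).
have icv := integrable_convolutionl fb gb mc cle.
have iJ : mu.-integrable [set: E] (EFin \o (fun x => J * (f x * g x))).
  have := bounded_in_cube_integrable
    (bounded_in_cubeZ J (bounded_in_cubeMr fb mg gS)).
  exact.
rewrite -(RintegralZl J measurableT ifg) -RintegralB//.
have S0 : 0 <= S by rewrite (le_trans _ (fS a)).
have J0 := Rintegral_bump_gt0.
have w0 : 0 <= w.
  by rewrite (le_trans _ (gw (x := 0) (y := 0) _))// => i; rewrite subrr normr0 ltW.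
apply: Rintegral_bound_cube; split.
- have := measurable_int _ (integrableB measurableT icv iJ).
  by move/measurable_EFinP.
- move=> x; rewrite mulrCA -mulrBr normrM ler_pM//.
  have gcb := bounded_in_cube_translate gb mc cle x.
  have bx := bounded_in_cube_bump x eps0.
  have cE y : c (x - y) = smooth_bump eps x y.
    by rewrite /c smooth_bump_sym -smooth_bump_shift.
  have JE : J = \int[mu]_y smooth_bump eps x y.
    rewrite /J -(Rintegral_shift (- x) (bounded_in_cube_bump 0 eps0)).
    by apply: eq_Rintegral => y _; rewrite -smooth_bump_shift.
  have ib := bounded_in_cube_integrable bx.
  have iz : mu.-integrable [set: E] (EFin \o (fun y => g x * smooth_bump eps x y)).
    exact: bounded_in_cube_integrable (bounded_in_cubeZ (g x) bx).
  have ig := bounded_in_cube_integrable gcb.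
  have iw : mu.-integrable [set: E] (EFin \o (fun y => w * smooth_bump eps x y)).
    exact: bounded_in_cube_integrable (bounded_in_cubeZ w bx).
  have E1 : J * g x = \int[mu]_y (g x * smooth_bump eps x y).
    by rewrite (RintegralZl _ measurableT ib) -JE mulrC.
  have E2 : w * J = \int[mu]_y (w * smooth_bump eps x y).
    by rewrite (RintegralZl _ measurableT ib) -JE.
  rewrite E1 E2 -RintegralB//.
  have id := integrableB measurableT ig iz.
  apply: (le_trans (le_normr_Rintegral measurableT id)).
  apply: le_Rintegral => //; first exact: integrable_norm id.
  move=> y _; rewrite /= cE -mulrBl normrM (ger0_norm (bump_ge0 _ _ _)).
  have [xy|xy] := pselect (cube x eps y).
    by rewrite ler_wpM2r ?bump_ge0// distrC gw.
  by rewrite (bump_support eps0 xy) !mulr0.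
- by move=> x xa; rewrite f0// !mul0r mulr0 subrr.
Qed.

End mollification.

(** The bump is even: as a function of [y], c(x - y) is the bump centred at [x], and its derivative
    is the opposite of the derivative of c taken at x - y. The product with [z] has compact support,
    so its derivative has integral 0. *)
Lemma Rintegral_bump_parts i a r S S' eps (z dz : E -> R) x : 0 < eps ->
  bounded_in_cube a r S z -> bounded_in_cube a r S' dz ->
  (forall y, is_derive y (delta_mx ord0 i) z (dz y)) ->
  \int[mu]_y (z y * dbump i eps 0 (x - y)) =
  \int[mu]_y (dz y * smooth_bump eps 0 (x - y)).
Proof.
move=> e0 zb dzb dzE; have [mz zS _] := zb; have [mdz dzS _] := dzb.
have bx := bounded_in_cube_bump x e0; have [mb bS _] := bx.
have dbx := bounded_in_cube_dbump i x e0; have [mdb dbS _] := dbx.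
have E1 y : dbump i eps 0 (x - y) = - dbump i eps x y.
  rewrite (dbump_shift _ _ x) -[y - x]opprB /dbump /paraboloid.
  rewrite !mxE !subr0 !mulrN opprK; congr (flat_exp _ (_ - _) * _).
  by apply: eq_bigr => j _; rewrite !mxE !subr0 sqrrN.
under eq_Rintegral do rewrite E1 mulrN.
under [RHS]eq_Rintegral do rewrite smooth_bump_sym -smooth_bump_shift.
have zbb := bounded_in_cubeMr zb mb bS.
have i1 := bounded_in_cubeMr zb mdb dbS.
have i2 := bounded_in_cubeMr dzb mb bS.
have dE y : is_derive y (delta_mx ord0 i) (fun y => z y * smooth_bump eps x y)
    (z y * dbump i eps x y + dz y * smooth_bump eps x y).
  have := is_deriveM (dzE y) (is_derive_bump i eps x y).
  by rewrite /GRing.scale/= [_ * dz y]mulrC.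
have [_ b1 _] := i1; have [_ b2 _] := i2.
have := Rintegral_derive0 zbb dE (fun y => le_trans (ler_normD _ _) (lerD (b1 y) (b2 y))).
have j1 := bounded_in_cube_integrable i1.
have j2 := bounded_in_cube_integrable i2.
rewrite RintegralD// => /eqP; rewrite addrC addr_eq0 => /eqP ->.
rewrite -mulN1r -(RintegralZl _ measurableT j1).
by apply: eq_Rintegral => y _; rewrite mulN1r.
Qed.

Lemma Rintegral_sum m (F : 'I_m -> E -> R) :
  (forall i, mu.-integrable [set: E] (EFin \o F i)) ->
  \int[mu]_x (\sum_(i < m) F i x) = \sum_(i < m) \int[mu]_x F i x.
Proof.
move=> iF.
suff [_ ->] : mu.-integrable [set: E] (EFin \o (fun x => \sum_(i < m) F i x)) /\
    \int[mu]_x (\sum_(i < m) F i x) = \sum_(i < m) \int[mu]_x F i x by [].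
elim: (index_enum _) => [|j s [IH1 IH2]].
  split; last first.
    by under eq_Rintegral do rewrite big_nil; rewrite Rintegral_cst// mul0r big_nil.
  have := @integrable0 _ _ _ mu setT; apply: eq_integrable => //.
  by move=> x _ /=; rewrite big_nil.
split.
  have := integrableD measurableT (iF j) IH1; apply: eq_integrable => // x _ /=.
  by rewrite big_cons EFinD.
by under eq_Rintegral do rewrite big_cons; rewrite RintegralD// IH2 big_cons.
Qed.

(* The bumps of radius [eps] around the points of the support of [z] are
   admissible test functions; averaging their identities against [z] and
   integrating by parts puts the derivative on [z], and letting [eps] tend to 0
   removes the bump. *)
Lemma weak_identity_C1 a r r' S S' (A : 'I_n -> E -> R) (h z : E -> R)
    (dz : 'I_n -> E -> R) : r' < r ->
  (forall i, bounded_in_cube a r S (A i)) -> bounded_in_cube a r S h ->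
  (forall eps y, 0 < eps -> cube y eps `<=` cube a r ->
    \sum_(i < n) \int[mu]_x (A i x * dbump i eps y x) =
    \int[mu]_x (h x * smooth_bump eps y x)) ->
  continuous z -> bounded_in_cube a r' S' z ->
  (forall i, continuous (dz i)) -> (forall i, bounded_in_cube a r' S' (dz i)) ->
  (forall i x, is_derive x (delta_mx ord0 i) z (dz i x)) ->
  \sum_(i < n) \int[mu]_x (A i x * dz i x) = \int[mu]_x (h x * z x).
Proof.
move=> rr' Ab hb weak cz zb cdz dzb dzE.
have S0 : 0 <= S by have [_ hS _] := hb; exact: le_trans (hS a).
pose m := fine (mu (cube a r)).
have m0 : 0 <= m by rewrite fine_ge0.
pose T := \sum_(i < n) \int[mu]_x (A i x * dz i x) - \int[mu]_x (h x * z x).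
(* Each of the n components and the right-hand side contributes a mollification error of at most
   [S * (w * J) * m]; division by [J] gives this bound. *)
suff Tle w : 0 < w -> `|T| <= w * (n.+1%:R * (S * m)).
  apply/eqP; rewrite -subr_eq0 -normr_le0; apply/ler_addgt0Pl => e e0.
  rewrite addr0; pose q := n.+1%:R * (S * m).
  have q0 : 0 <= q by rewrite !mulr_ge0.
  have q1 : 0 < q + 1 by rewrite ltr_wpDl.
  apply: (le_trans (Tle (e / (q + 1)) _)); first by rewrite divr_gt0.
  by rewrite -/q mulrAC ler_pdivrMr// ler_wpM2l ?ltW// ltrDl.
move=> w0.
have z0 x : ~ cube a r' x -> z x = 0 by have [_ _] := zb; exact.
have dz0 i x : ~ cube a r' x -> dz i x = 0 by have [_ _] := dzb i; exact.
(* The bound [eps < r - r'] keeps the bumps centred in the cube of radius [r'] inside the cube of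
   radius [r], where the identity is assumed. *)
have [eps [e0 er ew1 ew2]] : exists eps, [/\ 0 < eps, eps < r - r',
    forall x y, cube x eps y -> `|z x - z y| <= w &
    forall i x y, cube x eps y -> `|dz i x - dz i y| <= w].
  near (0 : R)^'+ => eps; exists eps; split.
  - by near: eps; exact: nbhs_right_gt.
  - by near: eps; apply: nbhs_right_lt; rewrite subr_gt0.
  - by near: eps; exact: (cube_uniformly_continuous cz z0).
  - near: eps; apply: filter_forall => i.
    exact: (cube_uniformly_continuous (cdz i) (dz0 i)).
pose c := smooth_bump eps (0 : E).
have [mc cle _] := bounded_in_cube_bump (0 : E) e0; rewrite -/c in mc cle.
pose J := \int[mu]_x c x; have J0 : 0 < J := Rintegral_bump_gt0 e0.
pose B i := \int[mu]_y (dz i y * \int[mu]_x (A i x * c (x - y))).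
pose C := \int[mu]_y (z y * \int[mu]_x (h x * c (x - y))).
have BC : \sum_(i < n) B i = C.
  have Bi i : B i = \int[mu]_y (z y * \int[mu]_x (A i x * dbump i eps 0 (x - y))).
    have [mdc dcle _] := bounded_in_cube_dbump i (0 : E) e0.
    rewrite /B -(Rintegral_convolution (Ab i) (dzb i) mc cle).
    rewrite -(Rintegral_convolution (Ab i) zb mdc dcle).
    apply: eq_Rintegral => x _; congr (_ * _).
    by rewrite (Rintegral_bump_parts x e0 zb (dzb i) (dzE i)).
  under eq_bigr do rewrite Bi.
  rewrite -Rintegral_sum; last first.
    move=> i; have [mdc dcle _] := bounded_in_cube_dbump i (0 : E) e0.
    exact: (integrable_convolutionr (Ab i) zb mdc dcle).
  apply: eq_Rintegral => y _; rewrite -mulr_sumr.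
  have [ya|/z0 ->] := pselect (cube a r' y); last by rewrite !mul0r.
  congr (_ * _).
  under eq_bigr do under eq_Rintegral do rewrite -dbump_shift.
  rewrite weak//.
    by apply: eq_Rintegral => x _; rewrite /c -smooth_bump_shift.
  move=> x xy j; have -> : x ord0 j - a ord0 j =
    (x ord0 j - y ord0 j) + (y ord0 j - a ord0 j) by ring.
  rewrite (le_trans (ler_normD _ _))// (le_trans (lerD (xy j) (ya j)))//.
  by move: er; lra.
have errB i : `|B i - J * \int[mu]_x (A i x * dz i x)| <= S * (w * J) * m.
  exact: (mollification_error e0 (Ab i) (dzb i) (ew2 i)).
have errC : `|C - J * \int[mu]_x (h x * z x)| <= S * (w * J) * m.
  exact: (mollification_error e0 hb zb ew1).
rewrite -(ler_pM2l J0) -(gtr0_norm J0) -normrM (gtr0_norm J0).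
have -> : J * T = (C - J * \int[mu]_x (h x * z x)) -
    \sum_(i < n) (B i - J * \int[mu]_x (A i x * dz i x)).
  rewrite sumrB -mulr_sumr BC /T; ring.
apply: (le_trans (ler_normB _ _)).
have -> : J * (w * (n.+1%:R * (S * m))) =
    S * (w * J) * m + \sum_(i < n) S * (w * J) * m.
  by rewrite sumr_const card_ord -mulr_natl -natr1; ring.
apply: lerD => //; apply: (le_trans (ler_norm_sum _ _ _)).
by apply: ler_sum => i _; exact: errB.
Unshelve. all: by end_near. Qed.

End density.

(** * The comparison principle *)

Section plaplacian_flux.
Context {R : realType} {n : nat}.
Implicit Types (a b v : 'I_n -> R) (p : R).

Definition sqnorm v : R := \sum_(i < n) v i ^+ 2.

(** The field |v|^(p-2) v; the power is put on |v|^2 so that no square root has to be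
    differentiated. *)
Definition flux p v (i : 'I_n) : R := sqnorm v `^ ((p - 2) / 2) * v i.

(* The derivative of [flux p v i] with respect to the [i]-th variable, when [v] is
   the gradient of a sum of functions of one variable whose second derivatives
   are the [e j]; here [q = (p - 2) / 2]. *)
Definition flux_deriv (q : R) v (e : 'I_n -> R) (i : 'I_n) : R :=
  sqnorm v `^ q * e i + 2 * q * sqnorm v `^ (q - 1) * (v i ^+ 2 * e i).

Lemma sqnorm_ge0 v : 0 <= sqnorm v.
Proof. by apply: sumr_ge0 => i _; exact: sqr_ge0. Qed.

Lemma le_coord_sqnorm v i : `|v i| <= Num.sqrt (sqnorm v).
Proof.
rewrite -sqrtr_sqr ler_sqrt ?sqnorm_ge0// /sqnorm (bigD1 i)//= lerDl.
by apply: sumr_ge0 => j _; exact: sqr_ge0.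
Qed.

Lemma cauchy_schwarz a b :
  \sum_(i < n) a i * b i <= Num.sqrt (sqnorm a) * Num.sqrt (sqnorm b).
Proof.
set s := Num.sqrt (sqnorm a); set t := Num.sqrt (sqnorm b).
have sE : s ^+ 2 = sqnorm a by rewrite sqr_sqrtr ?sqnorm_ge0.
have tE : t ^+ 2 = sqnorm b by rewrite sqr_sqrtr ?sqnorm_ge0.
have s0 : 0 <= s by exact: sqrtr_ge0.
have t0 : 0 <= t by exact: sqrtr_ge0.
have [s00|sn0] := eqVneq s 0.
  rewrite s00 mul0r big1// => i _.
  by have := le_coord_sqnorm a i; rewrite -/s s00 normr_le0 => /eqP ->; rewrite mul0r.
have [t00|tn0] := eqVneq t 0.
  rewrite t00 mulr0 big1// => i _.
  by have := le_coord_sqnorm b i; rewrite -/t t00 normr_le0 => /eqP ->; rewrite mulr0.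
have st0 : 0 < s * t by rewrite mulr_gt0// lt_neqAle eq_sym ?sn0 ?tn0.
have : 0 <= \sum_(i < n) (a i * t - b i * s) ^+ 2.
  by apply: sumr_ge0 => i _; exact: sqr_ge0.
have -> : \sum_(i < n) (a i * t - b i * s) ^+ 2 =
    2 * (s * t) * (s * t - \sum_(i < n) a i * b i).
  transitivity (sqnorm a * t ^+ 2 - 2 * (s * t) * (\sum_(i < n) a i * b i)
      + sqnorm b * s ^+ 2).
    rewrite /sqnorm !mulr_suml mulr_sumr -sumrB -big_split/=.
    by apply: eq_bigr => i _; ring.
  by rewrite -sE -tE; ring.
by rewrite pmulr_rge0 ?subr_ge0// mulr_gt0.
Qed.

(** With A = |v|^2 this is |v|^(p-2) |v| = |v|^(p-1). The exponent on the right is positive for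
    every p > 1, while (p - 2) / 2 is negative for p < 2; bounds and monotonicity of the flux both
    go through it. *)
Lemma flux_sqrt p (A : R) : 1 < p -> 0 <= A ->
  A `^ ((p - 2) / 2) * Num.sqrt A = A `^ ((p - 1) / 2).
Proof.
move=> p1; rewrite le_eqVlt => /predU1P[<-|A0].
  rewrite sqrtr0 mulr0 powR0//.
  by rewrite gt_eqF// divr_gt0// subr_gt0.
rewrite -powR12_sqrt ?ltW// -powRD; last by rewrite (gt_eqF A0) implybT.
by congr (_ `^ _); field.
Qed.

(** With s = |a| and t = |b|, the Cauchy-Schwarz inequality bounds the sum from below by (s^(p-1) -
    t^(p-1)) (s - t), whose factors have the same sign. *)
Lemma flux_monotone p a b : 1 < p ->
  0 <= \sum_(i < n) (flux p a i - flux p b i) * (a i - b i).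
Proof.
move=> p1; set q := (p - 2) / 2.
set s := Num.sqrt (sqnorm a); set t := Num.sqrt (sqnorm b).
have sE : s ^+ 2 = sqnorm a by rewrite sqr_sqrtr ?sqnorm_ge0.
have tE : t ^+ 2 = sqnorm b by rewrite sqr_sqrtr ?sqnorm_ge0.
have s0 : 0 <= s by exact: sqrtr_ge0.
have t0 : 0 <= t by exact: sqrtr_ge0.
have cs := cauchy_schwarz a b; rewrite -/s -/t in cs.
pose fa := sqnorm a `^ q; pose fb := sqnorm b `^ q.
have fa0 : 0 <= fa by exact: powR_ge0.
have fb0 : 0 <= fb by exact: powR_ge0.
have -> : \sum_(i < n) (flux p a i - flux p b i) * (a i - b i) =
    fa * s ^+ 2 + fb * t ^+ 2 - (fa + fb) * \sum_(i < n) a i * b i.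
  rewrite sE tE /sqnorm !mulr_sumr -big_split -sumrB/=.
  by apply: eq_bigr => i _; rewrite /flux -/q -/fa -/fb; ring.
apply: (@le_trans _ _ ((fa * s - fb * t) * (s - t))).
  have -> : fa * s = sqnorm a `^ ((p - 1) / 2) by rewrite flux_sqrt// sqnorm_ge0.
  have -> : fb * t = sqnorm b `^ ((p - 1) / 2) by rewrite flux_sqrt// sqnorm_ge0.
  have p2 : 0 <= (p - 1) / 2 by rewrite divr_ge0// subr_ge0 ltW.
  have [ab|/ltW ba] := leP (sqnorm a) (sqnorm b).
    rewrite mulr_le0//; rewrite subr_le0.
      by rewrite ge0_ler_powR// nnegrE sqnorm_ge0.
    by rewrite ler_sqrt ?sqnorm_ge0.
  rewrite mulr_ge0//; rewrite subr_ge0.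
    by rewrite ge0_ler_powR// nnegrE sqnorm_ge0.
  by rewrite ler_sqrt ?sqnorm_ge0.
have := ler_wpM2l (addr_ge0 fa0 fb0) cs; set c := \sum_(i < n) _ => h.
by rewrite -subr_ge0; move: h; rewrite -subr_ge0; congr (0 <= _); ring.
Qed.

Lemma flux_le p v (M : R) : 1 < p -> (forall i, `|v i| <= M) ->
  forall i, `|flux p v i| <= (n%:R * M ^+ 2) `^ ((p - 1) / 2).
Proof.
move=> p1 vM i; rewrite /flux normrM (ger0_norm (powR_ge0 _ _)).
apply: (@le_trans _ _ (sqnorm v `^ ((p - 2) / 2) * Num.sqrt (sqnorm v))).
  by rewrite ler_wpM2l ?powR_ge0// le_coord_sqnorm.
rewrite flux_sqrt ?sqnorm_ge0// ge0_ler_powR ?nnegrE ?sqnorm_ge0//.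
- by rewrite divr_ge0// subr_ge0 ltW.
- by rewrite mulr_ge0// sqr_ge0.
- have M0 : 0 <= M by exact: le_trans (vM i).
  have -> : n%:R * M ^+ 2 = \sum_(j < n) M ^+ 2.
    by rewrite sumr_const card_ord mulr_natl.
  apply: ler_sum => j _; rewrite -(real_normK (num_real (v j))).
  by rewrite ler_pXn2r ?nnegrE.
Qed.

End plaplacian_flux.

(** * Continuity at a point and restrictions to cubes *)

Section continuity_at.
Context {R : realType} {T : topologicalType}.
Implicit Types (f g : T -> R) (x : T).

Lemma continuous_at_cst (k : R) x : {for x, continuous (fun=> k : R)}.
Proof. exact: cvg_cst. Qed.

Lemma continuous_atD f g x : {for x, continuous f} -> {for x, continuous g} ->
  {for x, continuous (fun y => f y + g y)}.
Proof. by move=> cf cg; exact: cvgD. Qed.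

Lemma continuous_atM f g x : {for x, continuous f} -> {for x, continuous g} ->
  {for x, continuous (fun y => f y * g y)}.
Proof. by move=> cf cg; exact: cvgM. Qed.

Lemma continuous_atN f x : {for x, continuous f} ->
  {for x, continuous (fun y => - f y)}.
Proof. by move=> cf; exact: cvgN. Qed.

Lemma continuous_atB f g x : {for x, continuous f} -> {for x, continuous g} ->
  {for x, continuous (fun y => f y - g y)}.
Proof. by move=> cf cg; exact: cvgB. Qed.

Lemma continuous_at_comp (h : R -> R) f x : {for x, continuous f} ->
  {for f x, continuous h} -> {for x, continuous (fun y => h (f y))}.
Proof. by move=> cf ch; exact: (continuous_comp cf ch). Qed.

Lemma continuous_at_sum m (h : 'I_m -> T -> R) x :
  (forall j, {for x, continuous (h j)}) ->
  {for x, continuous (fun y => \sum_(j < m) h j y)}.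
Proof. by move=> ch; exact: (@cvg_sumr _ _ _ (nbhs_filter x)). Qed.

Lemma continuous_at_sqr f x : {for x, continuous f} ->
  {for x, continuous (fun y => f y ^+ 2)}.
Proof.
move=> cf; apply: (@continuous_at_comp (fun t => t ^+ 2) f x cf).
exact: exprn_continuous.
Qed.

Lemma continuous_at_powR (e : R) f x : {for x, continuous f} -> 0 < f x ->
  {for x, continuous (fun y => f y `^ e)}.
Proof.
move=> cf f0; apply: (@continuous_at_comp (fun t => t `^ e) f x cf).
exact: is_derive1_continuous (is_derive1_powR e f0).
Qed.

End continuity_at.

Lemma continuous_at_coord (R : realType) n j (x : 'rV[R]_n) :
  {for x, continuous (fun y : 'rV[R]_n => y ord0 j)}.
Proof. exact: coord_continuous. Qed.

Lemma restrict_bounded (R : realType) n (U : set 'rV[R]_n) a (r : R)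
    (h : 'rV[R]_n -> R) : open U -> cube a r `<=` U ->
  (forall x, U x -> {for x, continuous h}) ->
  exists S, bounded_in_cube a r S (h \_ (cube a r)).
Proof.
move=> oU aU ch; have mc := measurable_cube a r.
have out x : ~ cube a r x -> (h \_ (cube a r)) x = 0.
  by move=> ?; rewrite patchE memNset.
have mh : measurable_fun [set: 'rV[R]_n] (h \_ (cube a r)).
  apply/(measurable_restrictT _ mc).
  apply: (measurable_funS (open_measurable_rV oU) aU).
  exact: open_continuous_measurable_rV.
have [K0|K0] := pselect (cube a r !=set0); last first.
  exists 0; split => // x; rewrite out ?normr0// => Kx.
  by apply: K0; exists x.
have [|c _ cM] := @compact_EVT_max _ R (fun x => `|h x|) _ K0
  (compact_cube (y := a) (r := r)).
  apply: continuous_in_subspaceT => x; rewrite inE => /aU Ux.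
  exact: (continuous_comp (ch x Ux) (@norm_continuous _ _ _)).
exists `|h c|; split => // x.
have [Kx|/out ->] := pselect (cube a r x); last by rewrite normr0.
by rewrite patchE mem_set//; apply: cM; rewrite inE.
Qed.

Lemma bounded_in_cube_family (R : realType) n m a (r : R)
    (h : 'I_m -> 'rV[R]_n -> R) :
  (forall i, exists S, bounded_in_cube a r S (h i)) ->
  exists2 S, 0 <= S & forall i, bounded_in_cube a r S (h i).
Proof.
move=> /choice[S hS]; exists (\sum_(i < m) `|S i|).
  by apply: sumr_ge0.
move=> i; apply: (bounded_in_cubeW (lexx r) _ (hS i)).
rewrite (bigD1 i)//= (le_trans (ler_norm _))// lerDl.
by apply: sumr_ge0.
Qed.

(** * Extension by zero *)

Section patching.
Context {R : realType} {n : nat}.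
Local Notation E := 'rV[R]_n.
Variables (a : E) (r s : R) (rs : r < s).
Let K := cube a r.
Let U := ocube a s.

Lemma cube_sub_ocube : K `<=` U.
Proof. by move=> x xa i; exact: le_lt_trans (xa i) rs. Qed.

Lemma open_ocubeT : open U.
Proof.
rewrite openE => x xU; apply/nbhs_ballP.
pose d := \big[Order.min/1]_(i < n) (s - `|x ord0 i - a ord0 i|).
have d0 : 0 < d.
  by apply: lt_bigmin => // i _; rewrite subr_gt0; exact: xU.
exists d => // y [_ xy] i.
have yd : `|x ord0 i - y ord0 i| < d by exact: (xy ord0 i).
have di : d <= s - `|x ord0 i - a ord0 i| by exact: bigmin_le_cond.
have -> : y ord0 i - a ord0 i = (x ord0 i - a ord0 i) - (x ord0 i - y ord0 i) by ring.
by rewrite (le_lt_trans (ler_normB _ _))// -ltrBrDl (lt_le_trans yd).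
Qed.

Variable F : E -> R.
Hypothesis F0 : forall x, U x -> ~ K x -> F x = 0.

(** Because [r < s], the open sets [U] and the complement of [K] cover the space. On the first the
    extension by zero agrees with [F], on the second with 0, so regularity can be checked separately
    on each. *)
Lemma near_patch_in x : U x -> \forall y \near x, F y = (F \_ K) y.
Proof.
move=> Ux; have : nbhs x U by apply: open_nbhs_nbhs; split => //; exact: open_ocubeT.
apply: filterS => y Uy; rewrite patchE; case: ifPn => // /negP.
by rewrite inE => /(F0 Uy).
Qed.

Lemma near_patch_out x : ~ U x -> \forall y \near x, (cst 0 : E -> R) y = (F \_ K) y.
Proof.
move=> Ux; have : nbhs x (~` K).
  apply: open_nbhs_nbhs; split; last by move=> /cube_sub_ocube.
  by rewrite openC; exact: closed_cube.
by apply: filterS => y Ky; rewrite patchE memNset.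
Qed.

Lemma patch_continuous : (forall x, U x -> {for x, continuous F}) ->
  continuous (F \_ K).
Proof.
move=> cF x; have [Ux|Ux] := pselect (U x).
  have e := near_patch_in Ux.
  rewrite /continuous_at -(nbhs_singleton e).
  exact: (cvg_trans (near_eq_cvg e) (cF x Ux)).
have e := near_patch_out Ux.
rewrite /continuous_at -(nbhs_singleton e).
by apply: (cvg_trans (near_eq_cvg e)); exact: cvg_cst.
Qed.

Lemma patch_is_derive (F' : E -> R) (v : E) :
  (forall x, U x -> is_derive x v F (F' x)) ->
  (forall x, U x -> ~ K x -> F' x = 0) ->
  forall x, is_derive x v (F \_ K) ((F' \_ K) x).
Proof.
move=> dF F'0 x; have [Ux|Ux] := pselect (U x).
  have -> : (F' \_ K) x = F' x.
    by rewrite patchE; case: ifPn => // /negP; rewrite inE => /(F'0 _ Ux).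
  exact: (near_eq_is_derive (near_patch_in Ux) (dF x Ux)).
rewrite patchE memNset; last by move=> /cube_sub_ocube.
have d0 : is_derive x v (cst 0 : E -> R) 0 by exact: is_derive_cst.
exact: (near_eq_is_derive (near_patch_out Ux) d0).
Qed.

End patching.

(** * Comparison of a weak solution with a strict classical barrier *)

Section comparison.
Context {R : realType} {n : nat}.
Local Notation E := 'rV[R]_n.
Local Notation mu := (@lebesgue_rV R n).
Variables (p sigma : R) (x0 : E) (r1 r2 r : R).
Hypotheses (p1 : 1 < p) (r12 : r1 < r2) (r2r : r2 < r).
Let K := cube x0 r1.
Let K2 := cube x0 r2.
Let U := ocube x0 r.
Variables (u f : E -> R) (du : 'I_n -> E -> R).
Hypotheses (cu : forall x, U x -> {for x, continuous u}).
Hypotheses (uE : forall i x, U x -> is_derive x (delta_mx ord0 i) u (du i x)).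
Hypotheses (cdu : forall i x, U x -> {for x, continuous (du i)}).
Hypotheses (cf : forall x, U x -> {for x, continuous f}).
Let A i (x : E) := flux p (du^~ x) i.
Hypothesis weak : forall eps y, 0 < eps -> cube y eps `<=` K2 ->
  \int[mu]_x (\sum_(i < n) (A i \_ K2) x * dbump i eps y x) =
  \int[mu]_x ((f \_ K2) x * smooth_bump eps y x).
Variables (g g1 g2 : 'I_n -> R -> R).
Hypotheses (gE : forall x j, U x -> is_derive (x ord0 j) 1 (g j) (g1 j (x ord0 j))).
Hypotheses (g1E : forall x j, U x -> is_derive (x ord0 j) 1 (g1 j) (g2 j (x ord0 j))).
Hypotheses (cg2 : forall x j, U x -> {for x ord0 j, continuous (g2 j)}).
Let w (x : E) := \sum_(j < n) g j (x ord0 j).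
Let dw j (x : E) := g1 j (x ord0 j).
Let D (x : E) := sqnorm (dw^~ x).
Hypothesis D0 : forall x, U x -> 0 < D x.
Let q := (p - 2) / 2.
Let B i (x : E) := flux p (dw^~ x) i.
Let dflux i (x : E) := flux_deriv q (dw^~ x) (fun j => g2 j (x ord0 j)) i.
(** The function -Delta_p w, computed classically. *)
Let fw (x : E) := - \sum_(i < n) dflux i x.
Let z (x : E) := sigma * (u x - w x).
Hypothesis zK : forall x, U x -> ~ K x -> z x <= 0.
Hypothesis strict : forall x, U x -> 0 < z x -> 0 < sigma * (fw x - f x).

Let r1r : r1 < r. Proof. exact: lt_trans r2r. Qed.
Let KU : K `<=` U. Proof. exact: cube_sub_ocube. Qed.
Let K2U : K2 `<=` U. Proof. exact: cube_sub_ocube. Qed.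
Let KK2 : K `<=` K2.
Proof. by move=> x h i; exact: le_trans (h i) (ltW r12). Qed.
Let oU : open U. Proof. exact: open_ocubeT. Qed.

Let cdw j x : U x -> {for x, continuous (dw j)}.
Proof.
move=> Ux; apply: (continuous_at_comp (@continuous_at_coord _ _ j x)).
exact: is_derive1_continuous (g1E j Ux).
Qed.

Let cg2x j x : U x -> {for x, continuous (fun x : E => g2 j (x ord0 j))}.
Proof.
by move=> Ux; exact: (continuous_at_comp (@continuous_at_coord _ _ j x) (cg2 Ux)).
Qed.

Let cw x : U x -> {for x, continuous w}.
Proof.
move=> Ux; apply: continuous_at_sum => j.
apply: (continuous_at_comp (@continuous_at_coord _ _ j x)).
exact: is_derive1_continuous (gE j Ux).
Qed.

Let wE i x : U x -> is_derive x (delta_mx ord0 i) w (dw i x).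
Proof.
move=> Ux.
by apply: (@is_derive_separable _ _ g (fun j => g1 j (x ord0 j))) => j; exact: gE.
Qed.

Let cD x : U x -> {for x, continuous D}.
Proof.
by move=> Ux; apply: continuous_at_sum => j; apply: continuous_at_sqr; exact: cdw.
Qed.

Let DE i x : U x ->
  is_derive x (delta_mx ord0 i) D (2 * dw i x * g2 i (x ord0 i)).
Proof.
move=> Ux; apply: (@is_derive_separable _ _ (fun j t => g1 j t ^+ 2)
  (fun j => 2 * g1 j (x ord0 j) * g2 j (x ord0 j))) => j.
have := is_deriveM (g1E j Ux) (g1E j Ux).
rewrite /GRing.scale/=; congr (is_derive _ _ _ _); last by rewrite /dw; ring.
Qed.

Let cDpow e x : U x -> {for x, continuous (fun y : E => D y `^ e)}.
Proof. by move=> Ux; apply: continuous_at_powR; [exact: cD|exact: D0]. Qed.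

Let cB i x : U x -> {for x, continuous (B i)}.
Proof. by move=> Ux; exact: (continuous_atM (@cDpow q x Ux) (@cdw i x Ux)). Qed.

(** The nonvanishing gradient of [w] makes the power of [D] differentiable, and the diagonal Hessian
    leaves only the second derivative [g2 i]. *)
Let BE i x : U x -> is_derive x (delta_mx ord0 i) (B i) (dflux i x).
Proof.
move=> Ux.
have dwi : is_derive x (delta_mx ord0 i) (dw i) (g2 i (x ord0 i)).
  have := is_derive_comp1 (g1E i Ux) (is_derive_coord i x (delta_mx ord0 i)).
  by rewrite mxE !eqxx mulr1.
have dDq := is_derive_comp1 (is_derive1_powR q (D0 Ux)) (DE i Ux).
have := is_deriveM dDq dwi.
rewrite /GRing.scale/=; congr (is_derive _ _ _ _).
by rewrite /dflux /flux_deriv; ring.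
Qed.

Let cdflux i x : U x -> {for x, continuous (dflux i)}.
Proof.
move=> Ux; apply: continuous_atD.
  exact: (continuous_atM (@cDpow q x Ux) (@cg2x i x Ux)).
apply: continuous_atM.
  exact: (continuous_atM (@continuous_at_cst _ _ (2 * q) x) (@cDpow (q - 1) x Ux)).
exact: (continuous_atM (continuous_at_sqr (@cdw i x Ux)) (@cg2x i x Ux)).
Qed.

Let cfw x : U x -> {for x, continuous fw}.
Proof.
move=> Ux; apply: continuous_atN; apply: continuous_at_sum => i.
exact: cdflux.
Qed.

Let cz x : U x -> {for x, continuous z}.
Proof.
move=> Ux; apply: continuous_atM; first exact: continuous_at_cst.
exact: (continuous_atB (cu Ux) (cw Ux)).
Qed.

Let dz i (x : E) := sigma * (du i x - dw i x).

Let zE i x : U x -> is_derive x (delta_mx ord0 i) z (dz i x).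
Proof. by move=> Ux; exact: (is_deriveZ sigma (is_deriveB (uE i Ux) (wE i Ux))). Qed.

Let cdz i x : U x -> {for x, continuous (dz i)}.
Proof.
move=> Ux; have cd := continuous_atB (@cdu i x Ux) (@cdw i x Ux).
exact: (continuous_atM (@continuous_at_cst _ _ sigma x) cd).
Qed.

Let pos (t : R) := Num.max t 0.

Let pos_ge0 t : 0 <= pos t. Proof. by rewrite /pos le_max lexx orbT. Qed.

Let pos_le0 t : t <= 0 -> pos t = 0. Proof. by move=> t0; rewrite /pos max_r. Qed.

(** The square removes the corner of the positive part at 0; this is why the test function is
    squared. *)
Let is_derive_pos2 (t : R) : is_derive t 1 (fun s : R => pos s ^+ 2) (2 * pos t).
Proof.
have [t0|t0|->] := ltgtP t 0.
- rewrite pos_le0 ?ltW// mulr0.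
  have d0 : is_derive t 1 (cst (0 : R)) 0 by exact: is_derive_cst.
  apply: (near_eq_is_derive _ d0); near=> s.
  by rewrite pos_le0 ?expr0n// ltW//; near: s; exact: lt_nbhsl.
- have d2 : is_derive t 1 (fun s : R => s ^+ 2) (2 * pos t).
    have := is_derive_sqrB 0 t; rewrite subr0 /pos max_l ?ltW//.
    by congr (is_derive _ _ _ _); apply/funext => s; rewrite subr0.
  apply: (near_eq_is_derive _ d2); near=> s.
  by rewrite /pos max_l// ltW//; near: s; exact: lt_nbhsr.
- rewrite pos_le0// mulr0; apply: (@is_derive_sqr_bound _ _ 1) => s.
  rewrite mul1r ger0_norm ?sqr_ge0// /pos; case: (leP s 0) => // _.
  by rewrite expr0n sqr_ge0.
Unshelve. all: by end_near. Qed.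

Let cpos : continuous pos.
Proof.
move=> t; rewrite (_ : pos = fun s => (s + `|s|) / 2); last first.
  apply/funext => s; rewrite /pos; case: (leP s 0) => s0.
    by rewrite ler0_norm// subrr mul0r.
  by rewrite gtr0_norm//; field.
exact: (cvgM (cvgD cvg_id (@norm_continuous _ _ t)) (cvg_cst _)).
Qed.

Let F (x : E) := pos (z x) ^+ 2.
Let dF i (x : E) := 2 * pos (z x) * dz i x.

Let cposz x : U x -> {for x, continuous (fun y => pos (z y))}.
Proof. by move=> Ux; exact: (continuous_at_comp (cz Ux) (@cpos _)). Qed.

Let cF x : U x -> {for x, continuous F}.
Proof. by move=> Ux; exact: (continuous_at_sqr (cposz Ux)). Qed.

Let cdF i x : U x -> {for x, continuous (dF i)}.
Proof.
move=> Ux; have c2 := continuous_atM (@continuous_at_cst _ _ 2 x) (cposz Ux).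
exact: (continuous_atM c2 (@cdz i x Ux)).
Qed.

Let FE i x : U x -> is_derive x (delta_mx ord0 i) F (dF i x).
Proof. by move=> Ux; exact: (is_derive_comp1 (is_derive_pos2 _) (zE i Ux)). Qed.

Let F0 x : U x -> ~ K x -> F x = 0.
Proof. by move=> Ux Kx; rewrite /F pos_le0 ?expr0n//; exact: zK. Qed.

Let dF0 i x : U x -> ~ K x -> dF i x = 0.
Proof. by move=> Ux Kx; rewrite /dF pos_le0 ?mulr0 ?mul0r//; exact: zK. Qed.

Let bounded_K2 (h : E -> R) : (forall x, U x -> {for x, continuous h}) ->
  exists S, bounded_in_cube x0 r2 S (h \_ K2).
Proof. exact: restrict_bounded. Qed.

Let bounded_K (h : E -> R) : (forall x, U x -> {for x, continuous h}) ->
  exists S, bounded_in_cube x0 r1 S (h \_ K).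
Proof. exact: restrict_bounded. Qed.

Let csqdu x : U x -> {for x, continuous (fun y : E => sqnorm (du^~ y))}.
Proof.
by move=> Ux; apply: continuous_at_sum => i; apply: continuous_at_sqr; exact: cdu.
Qed.

(** The gradient of [u] may vanish, where the power can be singular. Hence the bound comes from
    [flux_le] and measurability from that of the power function, without continuity of the flux. *)
Let flux_bounded : exists2 S, 0 <= S & forall i, bounded_in_cube x0 r2 S (A i \_ K2).
Proof.
have [M M0 duM] := bounded_in_cube_family (fun i => bounded_K2 (@cdu i)).
exists ((n%:R * M ^+ 2) `^ ((p - 1) / 2)); first exact: powR_ge0.
move=> i; split.
- apply/(measurable_restrictT _ (measurable_cube x0 r2)).
  apply: (measurable_funS (open_measurable_rV oU) K2U).
  apply: measurable_funM; last first.
    by apply: (open_continuous_measurable_rV oU) => x; exact: cdu.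
  apply: (@measurableT_comp _ _ _ _ _ _ (fun t : R => t `^ ((p - 2) / 2)) _
    (fun y : E => sqnorm (du^~ y))); first exact: measurable_powR.
  exact: open_continuous_measurable_rV.
- move=> x; rewrite patchE; case: ifPn => [|_]; last by rewrite normr0 powR_ge0.
  rewrite inE => Kx; apply: flux_le => // j.
  by have [_ + _] := duM j => /(_ x); rewrite patchE mem_set.
- by move=> x ?; rewrite patchE memNset.
Qed.

Let zeta := F \_ K.
Let dzeta i := dF i \_ K.

Let zetaE i x : is_derive x (delta_mx ord0 i) zeta (dzeta i x).
Proof. exact: (patch_is_derive r1r F0 (fun x => @FE i x) (fun x => @dF0 i x)). Qed.

Let czeta : continuous zeta.
Proof. exact: (patch_continuous r1r F0 cF). Qed.

Let cdzeta i : continuous (dzeta i).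
Proof. exact: (patch_continuous r1r (fun x => @dF0 i x) (fun x => @cdF i x)). Qed.

Let zeta_bounded : exists S, bounded_in_cube x0 r1 S zeta /\
  forall i, bounded_in_cube x0 r1 S (dzeta i).
Proof.
have [S0 zS] := bounded_K cF.
have [S S_ge0 dzS] := bounded_in_cube_family (fun i => bounded_K (@cdF i)).
exists (`|S0| + S); split.
  apply: (bounded_in_cubeW (lexx r1) _ zS).
  by rewrite (le_trans (ler_norm _))// lerDl.
by move=> i; apply: (bounded_in_cubeW (lexx r1) _ (dzS i)); rewrite lerDr.
Qed.

Let prodK (h k : E -> R) x : (h \_ K2) x * (k \_ K) x = ((fun y => h y * k y) \_ K) x.
Proof.
rewrite !patchE; have [Kx|Kx] := pselect (K x).
  by rewrite (mem_set Kx) mem_set//; exact: KK2.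
by rewrite [in RHS](memNset Kx) [X in _ * X](_ : _ = 0) ?mulr0// (memNset Kx).
Qed.

(** Extended by zero, [B i * F] is differentiable in direction i on the whole space with bounded
    derivative, so this derivative has integral 0. *)
Let parts i : mu.-integrable [set: E] (EFin \o (fun x => (B i \_ K2) x * dzeta i x)) /\
  mu.-integrable [set: E] (EFin \o (fun x => (dflux i \_ K2) x * zeta x)) /\
  \int[mu]_x ((B i \_ K2) x * dzeta i x) = - \int[mu]_x ((dflux i \_ K2) x * zeta x).
Proof.
pose G x := B i x * F x; pose G1 x := B i x * dF i x; pose G2 x := dflux i x * F x.
have e1 : (fun x => (B i \_ K2) x * dzeta i x) = G1 \_ K.
  by apply/funext => x; rewrite prodK.
have e2 : (fun x => (dflux i \_ K2) x * zeta x) = G2 \_ K.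
  by apply/funext => x; rewrite prodK.
rewrite e1 e2.
have cG x : U x -> {for x, continuous G}.
  by move=> Ux; exact: (continuous_atM (@cB i x Ux) (cF Ux)).
have cG1 x : U x -> {for x, continuous G1}.
  by move=> Ux; exact: (continuous_atM (@cB i x Ux) (@cdF i x Ux)).
have cG2 x : U x -> {for x, continuous G2}.
  by move=> Ux; exact: (continuous_atM (@cdflux i x Ux) (cF Ux)).
have [S GS] := bounded_K cG; have [S1 G1S] := bounded_K cG1.
have [S2 G2S] := bounded_K cG2.
have G0 x : U x -> ~ K x -> G x = 0 by move=> Ux Kx; rewrite /G F0// mulr0.
have GE x : U x -> is_derive x (delta_mx ord0 i) G (G1 x + G2 x).
  move=> Ux; have := is_deriveM (BE i Ux) (FE i Ux).
  by rewrite /GRing.scale/= [F x * _]mulrC.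
have G12 x : U x -> ~ K x -> G1 x + G2 x = 0.
  by move=> Ux Kx; rewrite /G1 /G2 F0// dF0// !mulr0 addr0.
have dE := patch_is_derive r1r G0 GE G12.
have i1 := bounded_in_cube_integrable G1S.
have i2 := bounded_in_cube_integrable G2S.
do 2 (split => //).
have [_ b12 _] := bounded_in_cubeD G1S G2S.
have eD x : ((fun x => G1 x + G2 x) \_ K) x = (G1 \_ K) x + (G2 \_ K) x.
  by rewrite !patchE; case: ifP => _; rewrite ?addr0.
have dE' x : is_derive x (delta_mx ord0 i) (G \_ K) ((G1 \_ K) x + (G2 \_ K) x).
  by rewrite -eD; exact: dE.
have := Rintegral_derive0 GS dE' b12.
by rewrite RintegralD// => /eqP; rewrite addr_eq0 => /eqP.
Qed.

(** Both equations are tested with [zeta], the square of the positive part of [z]. By monotonicity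
    of the flux, sigma times the integral of (f - fw) zeta is nonnegative; by strictness it is
    negative if [z] is positive anywhere in [U]. Three cubes are involved: [zeta] lives in [K], the
    margin up to [K2] leaves room for mollification, and on the open set [U] around [K2] all
    derivatives exist. *)
Lemma comparison x : U x -> z x <= 0.
Proof.
move=> Ux; rewrite leNgt; apply/negP => zx0.
have [SA SA0 Ab] := flux_bounded; have [Sf fb] := bounded_K2 cf.
have [Sz [zb dzb]] := zeta_bounded.
have Ab' i : bounded_in_cube x0 r2 (SA + `|Sf|) (A i \_ K2).
  by apply: (bounded_in_cubeW (lexx r2) _ (Ab i)); rewrite lerDl.
have fb' : bounded_in_cube x0 r2 (SA + `|Sf|) (f \_ K2).
  apply: (bounded_in_cubeW (lexx r2) _ fb).
  by rewrite (le_trans (ler_norm _))// lerDr.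
have weak' eps y : 0 < eps -> cube y eps `<=` K2 ->
    \sum_(i < n) \int[mu]_x ((A i \_ K2) x * dbump i eps y x) =
    \int[mu]_x ((f \_ K2) x * smooth_bump eps y x).
  move=> e0 yK; rewrite -(weak e0 yK) Rintegral_sum// => i.
  have [mb bS _] := bounded_in_cube_dbump i y e0.
  exact: bounded_in_cube_integrable (bounded_in_cubeMr (Ab i) mb bS).
have W1 := weak_identity_C1 r12 Ab' fb' weak' czeta zb cdzeta dzb zetaE.
have [mz zS z0] := zb.
have iA i : mu.-integrable [set: E] (EFin \o (fun x => (A i \_ K2) x * dzeta i x)).
  have [md dS _] := dzb i.
  exact: bounded_in_cube_integrable (bounded_in_cubeMr (Ab i) md dS).
have iB i := (parts i).1; have iD i := (parts i).2.1; have pE i := (parts i).2.2.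
have [Sw fwb] := bounded_K2 cfw.
have jf := bounded_in_cube_integrable (bounded_in_cubeMr fb mz zS).
have jw := bounded_in_cube_integrable (bounded_in_cubeMr fwb mz zS).
have W2 : \sum_(i < n) \int[mu]_x ((B i \_ K2) x * dzeta i x) =
    \int[mu]_x ((fw \_ K2) x * zeta x).
  have iN i : mu.-integrable [set: E]
      (EFin \o (fun x => -1 * ((dflux i \_ K2) x * zeta x))).
    exact: (integrableZl measurableT (-1) (iD i)).
  under eq_bigr do rewrite pE -mulN1r -RintegralZl//.
  rewrite -Rintegral_sum//; apply: eq_Rintegral => y _.
  rewrite -mulr_sumr -mulr_suml mulrA mulN1r; congr (_ * _).
  rewrite patchE; case: ifPn => yK.
    by rewrite /fw; congr (- _); apply: eq_bigr => i _; rewrite patchE yK.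
  by rewrite big1 ?oppr0// => i _; rewrite patchE (negbTE yK).
pose H y := sigma * (fw y - f y) * F y.
have HE : (fun y => sigma * ((fw \_ K2) y * zeta y - (f \_ K2) y * zeta y)) = H \_ K.
  apply/funext => y; rewrite !prodK !patchE; case: ifP => _; rewrite ?subrr ?mulr0//.
  by rewrite /H; ring.
have P : 0 < \int[mu]_y (sigma * ((fw \_ K2) y * zeta y - (f \_ K2) y * zeta y)).
  rewrite HE; have cH y : U y -> {for y, continuous H}.
    move=> Uy; apply: continuous_atM; last exact: cF.
    have cfwf := continuous_atB (cfw Uy) (cf Uy).
    exact: (continuous_atM (@continuous_at_cst _ _ sigma y) cfwf).
  have [SH HS] := bounded_K cH.
  pose V := [set y | U y /\ 0 < z y].
  have Hpos y : V y -> 0 < H y.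
    move=> [Uy zy]; rewrite /H /F /pos max_l ?ltW// mulr_gt0 ?exprn_gt0//.
    exact: strict.
  apply: (Rintegral_gt0 HS _ (U := V) (x := x)).
  - move=> y; rewrite patchE; case: ifPn => //; rewrite inE => /KU Uy.
    have [zy|zy] := leP (z y) 0.
      by rewrite /H /F pos_le0// expr0n mulr0.
    by apply/ltW/Hpos.
  - rewrite openE => y [Uy zy]; apply: filterI; first exact: open_nbhs_nbhs.
    have hz : nbhs (z y) [set t : R | 0 < t].
      by apply: open_nbhs_nbhs; split => //; exact: open_gt.
    exact: (cz Uy hz).
  - by [].
  - move=> y Vy; rewrite patchE mem_set; first exact: Hpos.
    apply: contrapT => Ky; have [Uy zy] := Vy.
    by have := zK Uy Ky; rewrite leNgt zy.
(* The gradient of [zeta] contains one factor [sigma] and the outer one makes it a square, so both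
   orders of comparison rest on the same monotonicity. *)
have Nn : 0 <= \int[mu]_y (\sum_(i < n) sigma *
    ((A i \_ K2) y * dzeta i y - (B i \_ K2) y * dzeta i y)).
  apply: Rintegral_ge0 => y _.
  have -> : \sum_(i < n) sigma *
      ((A i \_ K2) y * dzeta i y - (B i \_ K2) y * dzeta i y) =
    ((fun y => 2 * pos (z y) * sigma ^+ 2 *
      \sum_(i < n) (A i y - B i y) * (du i y - dw i y)) \_ K) y.
    under eq_bigr do rewrite !prodK.
    rewrite patchE; case: ifPn => yK; last first.
      by rewrite big1// => i _; rewrite !patchE (negbTE yK) subrr mulr0.
    rewrite mulr_sumr; apply: eq_bigr => i _; rewrite !patchE yK.
    by rewrite /dF /dz; ring.
  rewrite patchE; case: ifPn => // _.
  apply: mulr_ge0; first by rewrite mulr_ge0 ?sqr_ge0// mulr_ge0.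
  exact: flux_monotone.
have iAB i : mu.-integrable [set: E] (EFin \o (fun y =>
    (A i \_ K2) y * dzeta i y - (B i \_ K2) y * dzeta i y)).
  exact: (integrableB measurableT (iA i) (iB i)).
have isAB i : mu.-integrable [set: E] (EFin \o (fun y => sigma *
    ((A i \_ K2) y * dzeta i y - (B i \_ K2) y * dzeta i y))).
  exact: (integrableZl measurableT sigma (iAB i)).
have jwf : mu.-integrable [set: E] (EFin \o (fun y =>
    (fw \_ K2) y * zeta y - (f \_ K2) y * zeta y)).
  exact: (integrableB measurableT jw jf).
move: Nn P; rewrite Rintegral_sum// (RintegralZl _ measurableT jwf) RintegralB//.
under eq_bigr do rewrite (RintegralZl _ measurableT (iAB _)) RintegralB//.
rewrite -mulr_sumr sumrB W1 W2.
set a := Rintegral _ _ _; set b := Rintegral _ _ _ => N1 P1.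
by move: N1 P1; lra.
Qed.

End comparison.

(** * The half-space and the exponents *)

Section half_space_facts.
Context {R : realType} {n : nat}.
Local Notation E := 'rV[R]_n.+1.
Local Notation Omega := (@half_space R n).
Local Notation mu := (@lebesgue_rV R n.+1).

Lemma open_half_space : open Omega.
Proof.
rewrite (_ : Omega = (fun x : E => x ord0 ord_max) @^-1` [set t | 0 < t]) //.
apply: open_comp; first by move=> x _; exact: coord_continuous.
exact: open_gt.
Qed.

Lemma closure_half_space (x : E) : closure Omega x -> 0 <= x ord0 ord_max.
Proof.
move=> cx; rewrite leNgt; apply/negP => x0.
have : nbhs x [set y : E | y ord0 ord_max < 0].
  apply: open_nbhs_nbhs; split => //.
  rewrite (_ : [set y | _] = (fun x : E => x ord0 ord_max) @^-1` [set t | t < 0]) //.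
  apply: open_comp; first by move=> y _; exact: coord_continuous.
  exact: open_lt.
by move=> /cx [y [/= y0]]; rewrite ltNge ltW.
Qed.

Lemma ocube_half_space (x : E) r : r <= x ord0 ord_max -> ocube x r `<=` Omega.
Proof.
move=> rx y /(_ ord_max); rewrite ltr_distl /= => /andP[+ _].
by apply: le_lt_trans; rewrite subr_ge0.
Qed.

Lemma enorm_powR (v : E) (s : R) : enorm v `^ s = sqnorm (v ord0) `^ (s / 2).
Proof.
have -> : sqnorm (v ord0) = dotv v v by apply: eq_bigr => i _; rewrite expr2.
have v0 : 0 <= dotv v v by apply: sumr_ge0 => i _; rewrite -expr2 sqr_ge0.
by rewrite /enorm -powR12_sqrt// -powRrM mulrC.
Qed.

Lemma dbump_support m i eps (y x : 'rV[R]_m) : 0 < eps -> ~ cube y eps x ->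
  dbump i eps y x = 0.
Proof. by move=> e0; have [_ _] := bounded_in_cube_dbump i y e0; exact. Qed.

(** The bump vanishes off the cube, so both integrands can be cut off there, and the behaviour of
    [u] near or beyond the boundary of the half-space no longer enters. *)
Lemma weak_solution_bump p gamma (u : E -> R) (a : E) r eps y :
  weak_solution p gamma u -> cube a r `<=` Omega -> 0 < eps ->
  cube y eps `<=` cube a r ->
  \int[mu]_x (\sum_(i < n.+1)
    ((fun x => flux p (fun i => partial i u x) i) \_ (cube a r)) x *
      dbump i eps y x) =
  \int[mu]_x (((fun x => u x `^ (- gamma)) \_ (cube a r)) x * smooth_bump eps y x).
Proof.
move=> weak aO e0 ya.
have tf := bump_test_function e0 (subset_trans ya aO).
have := congr1 fine (weak _ tf); rewrite -!/(Rintegral _ _ _).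
rewrite Rintegral_mkcond [RHS]Rintegral_mkcond.
have dE i x : partial i (smooth_bump eps y) x = dbump i eps y x.
  by have := is_derive_bump i eps y x => -[_ <-].
have -> : (fun x => enorm (grad u x) `^ (p - 2) *
      dotv (grad u x) (grad (smooth_bump eps y) x)) \_ Omega =
    (fun x => \sum_(i < n.+1)
      ((fun x => flux p (fun i => partial i u x) i) \_ (cube a r)) x *
      dbump i eps y x).
  apply/funext => x; have [xa|xa] := pselect (cube a r x).
    rewrite patchE mem_set; last exact: aO.
    rewrite enorm_powR /dotv mulr_sumr; apply: eq_bigr => i _.
    rewrite patchE mem_set// /flux !mxE dE mulrA; congr (_ `^ _ * _ * _).
    by apply: eq_bigr => j _; rewrite mxE.
  have d0 i : dbump i eps y x = 0 by apply: dbump_support => // /ya.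
  rewrite [RHS]big1; last by move=> i _; rewrite d0 mulr0.
  rewrite patchE; case: ifP => // _.
  by rewrite /dotv big1 ?mulr0// => i _; rewrite !mxE dE d0 mulr0.
have -> : (fun x => smooth_bump eps y x / u x `^ gamma) \_ Omega =
    (fun x => ((fun x => u x `^ (- gamma)) \_ (cube a r)) x * smooth_bump eps y x).
  apply/funext => x; have [xa|xa] := pselect (cube a r x).
    rewrite patchE mem_set; last exact: aO.
    by rewrite patchE mem_set// powRN mulrC.
  have b0 : smooth_bump eps y x = 0 by apply: bump_support => // /ya.
  by rewrite b0 mulr0 patchE; case: ifP => // _; rewrite b0 mul0r.
by [].
Qed.

End half_space_facts.

(** * Homogeneity of the p-Laplacian and the constants beta and M *)

Section scaling.
Context {R : realType} {n : nat}.

Lemma sqnormZ (H : R) (d : 'I_n -> R) :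
  sqnorm (fun j => H * d j) = H ^+ 2 * sqnorm d.
Proof. by rewrite /sqnorm mulr_sumr; apply: eq_bigr => j _; rewrite exprMn. Qed.

(** Homogeneity of degree 2q in the gradient and 1 in the Hessian; it carries the barrier from
    height 1 to height h. *)
Lemma flux_derivZ (q H G : R) (d e : 'I_n -> R) i : 0 < H ->
  flux_deriv q (fun j => H * d j) (fun j => G * e j) i =
  (H ^+ 2) `^ q * G * flux_deriv q d e i.
Proof.
move=> H0; have H2 : 0 < H ^+ 2 by rewrite exprn_gt0.
have pM s : (H ^+ 2 * sqnorm d) `^ s = (H ^+ 2) `^ s * sqnorm d `^ s.
  by rewrite powRM ?sqr_ge0 ?sqnorm_ge0.
rewrite /flux_deriv sqnormZ !pM.
have -> : (H ^+ 2) `^ q = (H ^+ 2) `^ (q - 1) * H ^+ 2.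
  rewrite -{3}(powRr1 (ltW H2)) -powRD; first by congr (_ `^ _); ring.
  by rewrite (gt_eqF H2) implybT.
by rewrite exprMn; ring.
Qed.

End scaling.

Section exponents.
Context {R : realType}.
Variables (p gamma : R).
Hypotheses (p1 : 1 < p) (gamma1 : 1 < gamma).
Local Notation beta := (beta_exponent p gamma).

Lemma denom_gt0 : 0 < gamma + p - 1.
Proof. by move: p1 gamma1; lra. Qed.

Lemma betaE : beta * (gamma + p - 1) = p.
Proof. by rewrite /beta_exponent divfK// gt_eqF// denom_gt0. Qed.

Lemma beta_gt0 : 0 < beta.
Proof. by rewrite divr_gt0 ?denom_gt0// (lt_trans _ p1). Qed.

(** The origin of beta: (beta - 1)(p - 2) + (beta - 2) = - beta gamma is the relation beta (gamma +
    p - 1) = p, and it makes the equation invariant under scaling. *)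
Lemma scale_exponent (h : R) : 0 < h ->
  ((h `^ (beta - 1)) ^+ 2) `^ ((p - 2) / 2) * h `^ (beta - 2) =
  h `^ (beta * (- gamma)).
Proof.
move=> h0; rewrite -powR_mulrn ?powR_ge0// -!powRrM -powRD; last first.
  by rewrite (gt_eqF h0) implybT.
congr (_ `^ _).
rewrite (_ : _ + _ = (beta * (gamma + p - 1) - p) - beta * gamma); last by field.
by rewrite betaE subrr add0r mulrN.
Qed.

(* For v = a x_N^beta, -Delta_p v - v^(-gamma) = barrier_defect a * x_N^(-beta gamma). *)
Definition barrier_defect (a : R) :=
  (p - 1) * (1 - beta) * (a * beta) `^ (p - 1) - a `^ (- gamma).

Lemma M_const_gt0 : 0 < M_const p gamma.
Proof.
have p0 : 0 < p by exact: lt_trans p1.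
rewrite /M_const powR_gt0// divr_gt0 ?powR_gt0 ?denom_gt0//.
by rewrite !mulr_gt0 ?powR_gt0 ?subr_gt0.
Qed.

(** Equivalent to the vanishing of [barrier_defect] at M, that is, to M x_N^beta being a
    solution. *)
Lemma M_constE : (p - 1) * (1 - beta) * beta `^ (p - 1) *
  M_const p gamma `^ (gamma + p - 1) = 1.
Proof.
have p0 : 0 < p by exact: lt_trans p1.
have d0 := denom_gt0.
rewrite /M_const -powRrM mulrC div1r mulVf ?gt_eqF// powRr1; last first.
  rewrite divr_ge0 ?powR_ge0// !mulr_ge0 ?powR_ge0 ?subr_ge0 ?ltW//.
have -> : 1 - beta = (gamma - 1) / (gamma + p - 1).
  by rewrite /beta_exponent; field; rewrite gt_eqF.
rewrite {1}/beta_exponent powRM ?invr_ge0 ?ltW//.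
have -> : (gamma + p - 1)^-1 `^ (p - 1) = (gamma + p - 1) / (gamma + p - 1) `^ p.
  rewrite -powR_inv1 ?ltW// -powRrM mulN1r.
  rewrite -{2}(powRr1 (ltW d0)) -powRN -powRD; first by congr (_ `^ _); ring.
  by rewrite (gt_eqF d0) implybT.
have g1 : gamma - 1 != 0 by rewrite subr_eq0 gt_eqF.
have q1 : p - 1 != 0 by rewrite subr_eq0 gt_eqF.
field; rewrite g1 q1 (lt0r_neq0 d0) (lt0r_neq0 (powR_gt0 _ d0)).
by rewrite (lt0r_neq0 (powR_gt0 _ p0)).
Qed.

(** In this factored form the sign is that of a - M, since gamma + p - 1 > 0. *)
Lemma barrier_defectE (a : R) : 0 < a -> barrier_defect a =
  a `^ (- gamma) * ((a / M_const p gamma) `^ (gamma + p - 1) - 1).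
Proof.
move=> a0; have b0 := beta_gt0; have M0 := M_const_gt0.
rewrite /barrier_defect powRM ?ltW// powRM ?invr_ge0 ?ltW//.
have -> : (M_const p gamma)^-1 `^ (gamma + p - 1) =
    (p - 1) * (1 - beta) * beta `^ (p - 1).
  rewrite -powR_inv1 ?ltW// -powRrM mulN1r powRN.
  have Mn : M_const p gamma `^ (gamma + p - 1) != 0.
    exact: lt0r_neq0 (powR_gt0 _ M0).
  by apply: (mulIf Mn); rewrite mulVf// M_constE.
have -> : a `^ (p - 1) = a `^ (- gamma) * a `^ (gamma + p - 1).
  rewrite -powRD; first by congr (_ `^ _); ring.
  by rewrite (gt_eqF a0) implybT.
ring.
Qed.

Lemma barrier_defect_gt0 (a : R) : M_const p gamma < a -> 0 < barrier_defect a.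
Proof.
move=> Ma; have M0 := M_const_gt0; have a0 : 0 < a by exact: lt_trans Ma.
rewrite barrier_defectE// mulr_gt0 ?powR_gt0// subr_gt0.
have aM : 1 < a / M_const p gamma by rewrite ltr_pdivlMr// mul1r.
have h0 : (0 : R) <= a / M_const p gamma by rewrite divr_ge0 ?ltW.
by have := gt0_ltr_powR denom_gt0 ler01 h0 aM; rewrite powR1.
Qed.

Lemma barrier_defect_lt0 (a : R) : 0 < a -> a < M_const p gamma ->
  barrier_defect a < 0.
Proof.
move=> a0 aM; have M0 := M_const_gt0.
rewrite barrier_defectE// pmulr_rlt0 ?powR_gt0// subr_lt0.
have aM1 : a / M_const p gamma < 1 by rewrite ltr_pdivrMr// mul1r.
have h0 : (0 : R) <= a / M_const p gamma by rewrite divr_ge0 ?ltW.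
by have := gt0_ltr_powR denom_gt0 h0 ler01 aM1; rewrite powR1.
Qed.

End exponents.

(** * The barrier *)

Lemma near_gt0 (R : realType) (T : topologicalType) (f : T -> R) (x : T) :
  {for x, continuous f} -> 0 < f x -> \forall y \near x, 0 < f y.
Proof.
move=> cf f0; have h : nbhs (f x) [set t : R | 0 < t].
  by apply: open_nbhs_nbhs; split => //; exact: open_gt.
exact: (cf _ h).
Qed.

Lemma is_derive_ext (R : numFieldType) (V W : normedModType R) (f f' : V -> W)
    (x v : V) (d d' : W) :
  is_derive x v f d -> f =1 f' -> d = d' -> is_derive x v f' d'.
Proof. by move=> fd /funext <- <-. Qed.

Lemma ler_powRN (R : realType) (c x y : R) : 0 <= c -> 0 < x -> x <= y ->
  y `^ (- c) <= x `^ (- c).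
Proof.
move=> c0 x0 xy; have y0 : 0 < y by exact: lt_le_trans xy.
rewrite !powRN lef_pV2 ?posrE ?powR_gt0//.
by apply: ge0_ler_powR; rewrite // nnegrE ltW.
Qed.

Section model_barrier.
Context {R : realType} {n : nat}.
Local Notation E := 'rV[R]_n.+1.
Variables (p gamma a sigma : R).
Hypotheses (a0 : 0 < a) (b0 : 0 < beta_exponent p gamma).
Hypothesis defect : 0 < sigma * barrier_defect p gamma a.
Let beta := beta_exponent p gamma.
Let q := (p - 2) / 2.
Implicit Types (k l : R) (y : E) (j : 'I_n.+1).

(* The gradient, (diagonal) Hessian, value and negative p-Laplacian of the barrier,
   rescaled to height 1, at the point x = x0 + y; the last argument of
   [model_value] stands for k r^2 / 2. *)
Definition model_grad k y j : R :=
  (if j == ord_max then a * beta * (1 + y ord0 ord_max) `^ (beta - 1) else 0) +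
  k * y ord0 j.

Definition model_hess k y j : R :=
  (if j == ord_max then a * beta * (beta - 1) * (1 + y ord0 ord_max) `^ (beta - 2)
   else 0) + k.

Definition model_value k y l : R :=
  a * (1 + y ord0 ord_max) `^ beta - l + k / 2 * \sum_(j < n.+1) y ord0 j ^+ 2.

Definition model_plap k y : R :=
  - \sum_(j < n.+1) flux_deriv q (model_grad k y) (model_hess k y) j.

Let o : R * E * R := (0, 0, 0).

Let cs : {for o, continuous (fun v : R * E * R => 1 + v.1.2 ord0 ord_max)}.
Proof.
apply: continuous_atD; first exact: continuous_at_cst.
have c2 : {for o, continuous (fun v : R * E * R => v.1.2)}.
  by apply: cvg_comp; [exact: cvg_fst|exact: cvg_snd].
exact: (continuous_comp c2 (@continuous_at_coord _ _ _ _)).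
Qed.

Let cy j : {for o, continuous (fun v : R * E * R => v.1.2 ord0 j)}.
Proof.
have c2 : {for o, continuous (fun v : R * E * R => v.1.2)}.
  by apply: cvg_comp; [exact: cvg_fst|exact: cvg_snd].
exact: (continuous_comp c2 (@continuous_at_coord _ _ _ _)).
Qed.

Let ck : {for o, continuous (fun v : R * E * R => v.1.1)}.
Proof. by apply: cvg_comp; [exact: cvg_fst|exact: cvg_fst]. Qed.

Let cl : {for o, continuous (fun v : R * E * R => v.2)}.
Proof. exact: cvg_snd. Qed.

Let so : 1 + o.1.2 ord0 ord_max = 1.
Proof. by rewrite /= mxE addr0. Qed.

Let cspow e : {for o, continuous (fun v : R * E * R => (1 + v.1.2 ord0 ord_max) `^ e)}.
Proof. by apply: continuous_at_powR; [exact: cs|rewrite so]. Qed.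

Let cgrad j : {for o, continuous (fun v : R * E * R => model_grad v.1.1 v.1.2 j)}.
Proof.
rewrite /model_grad; apply: continuous_atD; last exact: (continuous_atM ck (@cy j)).
case: (j == ord_max); last exact: continuous_at_cst.
exact: (continuous_atM (@continuous_at_cst _ _ (a * beta) o) (@cspow (beta - 1))).
Qed.

Let chess j : {for o, continuous (fun v : R * E * R => model_hess v.1.1 v.1.2 j)}.
Proof.
rewrite /model_hess; apply: continuous_atD; last exact: ck.
case: (j == ord_max); last exact: continuous_at_cst.
exact: (continuous_atM (@continuous_at_cst _ _ (a * beta * (beta - 1)) o)
  (@cspow (beta - 2))).
Qed.

Let cvalue : {for o, continuous (fun v : R * E * R => model_value v.1.1 v.1.2 v.2)}.
Proof.
apply: continuous_atD.
  apply: continuous_atB; last exact: cl.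
  exact: (continuous_atM (@continuous_at_cst _ _ a o) (@cspow beta)).
apply: continuous_atM.
  exact: (continuous_atM ck (@continuous_at_cst _ _ 2^-1 o)).
by apply: continuous_at_sum => j; apply: continuous_at_sqr; exact: cy.
Qed.

Let csq : {for o, continuous (fun v : R * E * R => sqnorm (model_grad v.1.1 v.1.2))}.
Proof.
by apply: continuous_at_sum => j; apply: continuous_at_sqr; exact: cgrad.
Qed.

Let grad_o j : model_grad 0 0 j = if j == ord_max then a * beta else 0.
Proof. by rewrite /model_grad !mxE mul0r addr0 addr0 powR1 mulr1. Qed.

Let hess_o j : model_hess 0 0 j = if j == ord_max then a * beta * (beta - 1) else 0.
Proof. by rewrite /model_hess !mxE addr0 addr0 powR1 mulr1. Qed.

Let value_o : model_value 0 0 0 = a.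
Proof. by rewrite /model_value mxE addr0 powR1 mulr1 subr0 !mul0r addr0. Qed.

Let ab0 : 0 < a * beta. Proof. by rewrite mulr_gt0. Qed.

Let sq_o : sqnorm (model_grad 0 0) = (a * beta) ^+ 2.
Proof.
rewrite /sqnorm (bigD1 ord_max)//= grad_o eqxx big1 ?addr0// => j jN.
by rewrite grad_o (negbTE jN) expr0n.
Qed.

Let sq_o_gt0 : 0 < sqnorm (model_grad 0 0).
Proof. by rewrite sq_o exprn_gt0. Qed.

Let cplap : {for o, continuous (fun v : R * E * R => model_plap v.1.1 v.1.2)}.
Proof.
have cpow e : {for o, continuous
    (fun v : R * E * R => sqnorm (model_grad v.1.1 v.1.2) `^ e)}.
  by apply: continuous_at_powR; [exact: csq|exact: sq_o_gt0].
apply: continuous_atN; apply: continuous_at_sum => j; apply: continuous_atD.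
  exact: (continuous_atM (@cpow q) (@chess j)).
apply: continuous_atM.
  exact: (continuous_atM (@continuous_at_cst _ _ (2 * q) o) (@cpow (q - 1))).
exact: (continuous_atM (continuous_at_sqr (@cgrad j)) (@chess j)).
Qed.

(** Without perturbation only the last coordinate has a nonzero Hessian entry, and the two terms of
    [flux_deriv] add up to the factor 1 + 2q = p - 1. *)
Let plap_o : model_plap 0 0 = (p - 1) * (1 - beta) * (a * beta) `^ (p - 1).
Proof.
rewrite /model_plap (bigD1 ord_max)//= big1 ?addr0; last first.
  by move=> j jN; rewrite /flux_deriv hess_o (negbTE jN) !mulr0 addr0.
rewrite /flux_deriv sq_o grad_o hess_o eqxx.
have ab20 : 0 < (a * beta) ^+ 2 by rewrite exprn_gt0.
have e1 : ((a * beta) ^+ 2) `^ q = ((a * beta) ^+ 2) `^ (q - 1) * (a * beta) ^+ 2.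
  rewrite -{3}(powRr1 (ltW ab20)) -powRD; first by congr (_ `^ _); ring.
  by rewrite (gt_eqF ab20) implybT.
have e2 : (a * beta) `^ (p - 1) = ((a * beta) ^+ 2) `^ q * (a * beta).
  rewrite -powR_mulrn ?ltW// -powRrM -{3}(powRr1 (ltW ab0)) -powRD.
    by congr (_ `^ _); rewrite /q; field.
  by rewrite (gt_eqF ab0) implybT.
rewrite e2; move: e1; set X := _ `^ q; set Y := _ `^ (q - 1) => e1.
transitivity (- (X + 2 * q * (Y * (a * beta) ^+ 2)) * (a * beta * (beta - 1))).
  by ring.
by rewrite -e1 /q; field.
Qed.

(** The four quantities are jointly continuous in (k, y, l) at the origin, where they equal 1, (a
    beta)^2, a and sigma times the defect, all positive. Working at height 1 makes [delta]
    independent of the point x0. *)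
Lemma model_barrier : exists2 delta, 0 < delta & forall k y l, `|k| < delta ->
  (forall j, `|y ord0 j| < delta) -> `|l| < delta ->
  [/\ 0 < 1 + y ord0 ord_max, 0 < sqnorm (model_grad k y), 0 < model_value k y l &
      0 < sigma * (model_plap k y - model_value k y l `^ (- gamma))].
Proof.
have cstrict : {for o, continuous (fun v : R * E * R =>
    sigma * (model_plap v.1.1 v.1.2 - model_value v.1.1 v.1.2 v.2 `^ (- gamma)))}.
  apply: continuous_atM; first exact: continuous_at_cst.
  apply: continuous_atB; first exact: cplap.
  by apply: continuous_at_powR; [exact: cvalue|rewrite value_o].
have n1 := near_gt0 cs; rewrite so in n1.
have n2 := near_gt0 csq sq_o_gt0.
have n3 := near_gt0 cvalue; rewrite value_o in n3.
have n4 := near_gt0 cstrict; rewrite /= value_o plap_o in n4.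
pose P (v : R * E * R) := [/\ 0 < 1 + v.1.2 ord0 ord_max,
    0 < sqnorm (model_grad v.1.1 v.1.2), 0 < model_value v.1.1 v.1.2 v.2 &
    0 < sigma * (model_plap v.1.1 v.1.2 - model_value v.1.1 v.1.2 v.2 `^ (- gamma))].
have /nbhs_ballP[d /= d0 dP] : \forall v \near o, P v.
  by near=> v; split; near: v; [exact: n1|exact: n2|exact: n3|exact: n4].
exists d => // k y l kd yd ld.
have kyl : ball o d (k, y, l).
  split; last by rewrite /ball/= sub0r normrN.
  split; first by rewrite /ball/= sub0r normrN.
  by split => // i j; rewrite (ord1 i) /ball/= mxE sub0r normrN.
exact: (dP _ kyl).
Unshelve. all: by end_near. Qed.

End model_barrier.

(** * A uniform gain from the barrier *)

Section improvement.
Context {R : realType} {n : nat}.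
Local Notation E := 'rV[R]_n.+1.
Local Notation Omega := (@half_space R n).
Local Notation N := (@ord_max n).
Variables (p gamma a sigma : R) (u : E -> R).
Hypotheses (p1 : 1 < p) (gamma1 : 1 < gamma) (a0 : 0 < a).
Hypotheses (sigma1 : sigma = 1 \/ sigma = -1).
Hypothesis defect : 0 < sigma * barrier_defect p gamma a.
Hypotheses (uC1 : Ck 1 Omega u) (ueq : weak_solution p gamma u).
Hypotheses (upos : forall x, Omega x -> 0 < u x).
Let beta := beta_exponent p gamma.
Hypothesis ubound : forall x, Omega x -> sigma * (u x - a * x ord0 N `^ beta) <= 0.

Let sigma2 : sigma * sigma = 1.
Proof. by case: sigma1 => ->; rewrite ?mulrNN mulr1. Qed.

Let sigma_norm : `|sigma| = 1.
Proof. by case: sigma1 => ->; rewrite ?normrN normr1. Qed.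

Let cu x : Omega x -> {for x, continuous u}.
Proof.
move=> Ox; have [+ _] := uC1.
by rewrite continuous_open_subspace; [apply; rewrite inE|exact: open_half_space].
Qed.

Let cdu i x : Omega x -> {for x, continuous (partial i u)}.
Proof.
move=> Ox; have [_ /(_ i) [_]] := uC1.
by rewrite /= continuous_open_subspace; [apply; rewrite inE|exact: open_half_space].
Qed.

Let uE i x : Omega x -> is_derive x (delta_mx ord0 i) u (partial i u x).
Proof. by move=> Ox; have [_ /(_ i) [/(_ x Ox)/derivableP]] := uC1. Qed.

Section at_point.
Variables (delta : R) (x0 : E).
Hypotheses (delta0 : 0 < delta) (Ox0 : Omega x0).
Hypothesis deltaP : forall (k : R) (y : E) (l : R), `|k| < delta ->
  (forall j, `|y ord0 j| < delta) -> `|l| < delta ->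
  [/\ 0 < 1 + y ord0 N, 0 < sqnorm (model_grad p gamma a k y),
      0 < model_value p gamma a k y l &
      0 < sigma * (model_plap p gamma a k y - model_value p gamma a k y l `^ (- gamma))].
Let h := x0 ord0 N.
Let h0 : 0 < h. Proof. exact: Ox0. Qed.
Variable rho : R.
Hypotheses (rho0 : 0 < rho) (rho1 : rho < 1) (rhod : rho < delta).
(** One parameter serves for both smallness conditions: the quadratic term has coefficient [rho],
    signed by [sigma], and its level set through the constant [l] is the sphere of radius rho h /
    2. *)
Let k := sigma * rho.
Let l := k / 2 * (rho / 2) ^+ 2.
Let H := h `^ (beta - 1).
Let G := h `^ (beta - 2).
Let y (x : E) : E := h^-1 *: (x - x0).
Let U := ocube x0 (rho * h).

(** The constant term is attached to the last coordinate, which keeps the barrier a sum of functions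
    of one variable. *)
Let g (j : 'I_n.+1) (s : R) : R :=
  (if j == N then a * s `^ beta - h `^ beta * l else 0) +
  (k * G / 2) * (s - x0 ord0 j) ^+ 2.
Let g1 (j : 'I_n.+1) (s : R) : R :=
  (if j == N then a * beta * s `^ (beta - 1) else 0) + k * G * (s - x0 ord0 j).
Let g2 (j : 'I_n.+1) (s : R) : R :=
  (if j == N then a * beta * (beta - 1) * s `^ (beta - 2) else 0) + k * G.

Let H0 : 0 < H. Proof. exact: powR_gt0. Qed.
Let G0 : 0 < G. Proof. exact: powR_gt0. Qed.

Let hpow e m : h `^ e * h ^+ m = h `^ (e + m%:R).
Proof.
rewrite -powR_mulrn ?ltW// -powRD//; by rewrite (gt_eqF h0) implybT.
Qed.

Let GH : G * h = H.
Proof. by rewrite -[X in _ * X]expr1 hpow; congr (_ `^ _); ring. Qed.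

Let Gh2 : G * h ^+ 2 = h `^ beta.
Proof. by rewrite hpow; congr (_ `^ _); ring. Qed.

Let UO : U `<=` Omega.
Proof.
by apply: ocube_half_space; rewrite ler_piMl ?ltW.
Qed.

Let xE (x : E) j : x ord0 j - x0 ord0 j = h * y x ord0 j.
Proof. by rewrite !mxE mulrA mulfV ?mul1r// gt_eqF. Qed.

Let xN (x : E) : x ord0 N = h * (1 + y x ord0 N).
Proof. by rewrite mulrDr mulr1 -xE /h addrC subrK. Qed.

Let yU (x : E) : U x -> forall j, `|y x ord0 j| < delta.
Proof.
move=> Ux j; apply: (lt_trans _ rhod); have := Ux j.
by rewrite xE normrM (gtr0_norm h0) mulrC ltr_pM2r.
Qed.

Let kd : `|k| < delta.
Proof. by rewrite normrM sigma_norm mul1r gtr0_norm. Qed.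

Let ld : `|l| < delta.
Proof.
rewrite normrM normrM (_ : `|k| = rho); last by rewrite normrM sigma_norm mul1r gtr0_norm.
rewrite !ger0_norm ?sqr_ge0//; apply: le_lt_trans rhod.
rewrite -mulrA ler_piMr ?(ltW rho0)// mulr_ile1//; first by rewrite sqr_ge0.
  by rewrite invf_le1// ler1n.
by rewrite expr_le1// ?divr_ge0 ?ltW//; move: rho1; lra.
Qed.

Let good x (Ux : U x) := deltaP kd (yU Ux) ld.

Let xN_gt0 x : U x -> 0 < x ord0 N.
Proof. by move=> /UO. Qed.

Let powxN x e : U x -> x ord0 N `^ e = h `^ e * (1 + y x ord0 N) `^ e.
Proof.
by move=> Ux; have [s0 _ _ _] := good Ux; rewrite xN powRM ?ltW.
Qed.

Let g1E x j : U x -> g1 j (x ord0 j) = H * model_grad p gamma a k (y x) j.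
Proof.
move=> Ux; rewrite /g1 /model_grad xE -GH; have [->|_] := eqVneq j N.
  by rewrite powxN// -/H -GH -/beta; ring.
by ring.
Qed.

Let g2E x j : U x -> g2 j (x ord0 j) = G * model_hess p gamma a k (y x) j.
Proof.
move=> Ux; rewrite /g2 /model_hess; have [->|_] := eqVneq j N.
  by rewrite powxN// -/G -/beta; ring.
by ring.
Qed.

Let w (x : E) := \sum_(j < n.+1) g j (x ord0 j).

Let wE x : w x = a * x ord0 N `^ beta - h `^ beta * l +
  k * G / 2 * \sum_(j < n.+1) (x ord0 j - x0 ord0 j) ^+ 2.
Proof.
rewrite /w /g big_split/= -mulr_sumr; congr (_ + _).
by rewrite (bigD1 N)//= eqxx big1 ?addr0// => j /negbTE ->.
Qed.

Let wE' x : U x -> w x = h `^ beta * model_value p gamma a k (y x) l.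
Proof.
move=> Ux; rewrite wE /model_value powxN//.
under eq_bigr do rewrite xE exprMn; rewrite -mulr_sumr.
set S := \sum_(_ < _) _; rewrite -Gh2; ring.
Qed.

Let plapE x : U x ->
  - \sum_(i < n.+1) flux_deriv ((p - 2) / 2) (fun j => g1 j (x ord0 j))
      (fun j => g2 j (x ord0 j)) i =
  h `^ (beta * (- gamma)) * model_plap p gamma a k (y x).
Proof.
move=> Ux; rewrite /model_plap mulrN mulr_sumr; congr (- _); apply: eq_bigr => i _.
rewrite -(scale_exponent p1 gamma1 h0) -/beta -/H -/G -flux_derivZ//.
by congr (flux_deriv _ _ _ i); apply/funext => j; [exact: g1E|exact: g2E].
Qed.

Let dquad c j (t : R) :
  is_derive t 1 (fun s => c / 2 * (s - x0 ord0 j) ^+ 2) (c * (t - x0 ord0 j)).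
Proof.
apply: (is_derive_ext (is_deriveZ (c / 2) (is_derive_sqrB (x0 ord0 j) t))) => //.
by rewrite /GRing.scale/=; field.
Qed.

Let dg x j : U x -> is_derive (x ord0 j) 1 (g j) (g1 j (x ord0 j)).
Proof.
move=> Ux; rewrite /g /g1; have [->|_] := eqVneq j N; last first.
  apply: (is_derive_ext (dquad (k * G) j (x ord0 j))); last by rewrite add0r.
  by move=> s; rewrite add0r.
have d1 := is_deriveZ a (is_derive1_powR beta (xN_gt0 Ux)).
have d2 := is_deriveB d1 (is_derive_cst (h `^ beta * l) (x ord0 N) 1).
apply: (is_derive_ext (is_deriveD d2 (dquad (k * G) N (x ord0 N)))) => //.
by rewrite /GRing.scale/= subr0 mulrA.
Qed.

Let dlin c j (t : R) : is_derive t 1 (fun s => c * (s - x0 ord0 j)) c.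
Proof.
apply: (is_derive_ext (is_deriveZ c
  (is_deriveB (is_derive_id t 1) (is_derive_cst (x0 ord0 j) t 1)))) => //.
by rewrite /GRing.scale/= subr0 mulr1.
Qed.

Let dg1 x j : U x -> is_derive (x ord0 j) 1 (g1 j) (g2 j (x ord0 j)).
Proof.
move=> Ux; rewrite /g1 /g2; have [->|_] := eqVneq j N; last first.
  apply: (is_derive_ext (dlin (k * G) j (x ord0 j))); last by rewrite add0r.
  by move=> s; rewrite add0r.
have d1 := is_deriveZ (a * beta) (is_derive1_powR (beta - 1) (xN_gt0 Ux)).
apply: (is_derive_ext (is_deriveD d1 (dlin (k * G) N (x ord0 N)))) => //.
rewrite /GRing.scale/= (_ : beta - 1 - 1 = beta - 2); last by ring.
by rewrite mulrA.
Qed.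

Let cg2 x j : U x -> {for x ord0 j, continuous (g2 j)}.
Proof.
move=> Ux; rewrite /g2; apply: continuous_atD; last exact: continuous_at_cst.
have [->|_] := eqVneq j N; last exact: continuous_at_cst.
apply: continuous_atM; first exact: continuous_at_cst.
exact: is_derive1_continuous (is_derive1_powR (beta - 2) (xN_gt0 Ux)).
Qed.

Let sigmak : sigma * k = rho.
Proof. by rewrite mulrA sigma2 mul1r. Qed.

Let cf x : U x -> {for x, continuous (fun x => u x `^ (- gamma))}.
Proof.
by move=> /UO Ox; apply: continuous_at_powR; [exact: cu|exact: upos].
Qed.

Let grad_gt0 x : U x -> 0 < sqnorm (fun j => g1 j (x ord0 j)).
Proof.
move=> Ux; have -> : (fun j => g1 j (x ord0 j)) =
    (fun j => H * model_grad p gamma a k (y x) j).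
  by apply/funext => j; exact: g1E.
by rewrite sqnormZ mulr_gt0 ?exprn_gt0//; have [] := good Ux.
Qed.

(** Off the cube a single coordinate already makes |x - x0|^2 at least (rho h / 2)^2, so the
    perturbation added to a x_N^beta has the sign of [sigma], or is 0. *)
Let boundary_order x : U x -> ~ cube x0 (rho * h / 2) x -> sigma * (u x - w x) <= 0.
Proof.
move=> Ux /existsNP[j /negP]; rewrite -ltNge => xj.
have rh0 : 0 <= rho * h / 2 by rewrite divr_ge0// mulr_ge0 ?ltW.
have S0 : (rho * h / 2) ^+ 2 <= \sum_(j < n.+1) (x ord0 j - x0 ord0 j) ^+ 2.
  rewrite (bigD1 j)//= -[leLHS]addr0 lerD//.
    rewrite -(real_normK (num_real (x ord0 j - _))).
    by rewrite ler_pXn2r ?nnegrE// ltW.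
  by apply: sumr_ge0 => i _; exact: sqr_ge0.
rewrite wE; set S := \sum_(_ < _) _ in S0 *.
have -> : sigma * (u x - (a * x ord0 N `^ beta - h `^ beta * l + k * G / 2 * S)) =
    sigma * (u x - a * x ord0 N `^ beta)
    + (sigma * k) * G / 2 * ((rho * h / 2) ^+ 2 - S).
  by rewrite /l -Gh2; field.
rewrite sigmak -[leRHS]addr0 lerD ?ubound//; first exact: UO.
rewrite mulr_ge0_le0 ?subr_le0//.
by rewrite divr_ge0// mulr_ge0 ?ltW.
Qed.

(** The barrier satisfies the strict inequality with its own power w^(-gamma). Where sigma (u - w) >
    0, the decrease of t^(-gamma) allows u to replace w. *)
Let strict_barrier x : U x -> 0 < sigma * (u x - w x) ->
  0 < sigma * (- \sum_(i < n.+1) flux_deriv ((p - 2) / 2) (fun j => g1 j (x ord0 j))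
      (fun j => g2 j (x ord0 j)) i - u x `^ (- gamma)).
Proof.
move=> Ux uw; have [_ _ v0 vP] := good Ux.
have hb0 : 0 < h `^ beta by exact: powR_gt0.
have w0 : 0 < w x by rewrite wE'// mulr_gt0.
have u0 := upos (UO Ux).
have g0 : 0 <= gamma by rewrite ltW// (lt_trans _ gamma1).
have key : 0 <= sigma * (w x `^ (- gamma) - u x `^ (- gamma)).
  case: sigma1 uw => ->.
    by rewrite !mul1r subr_gt0 subr_ge0 => /ltW; exact: ler_powRN.
  by rewrite !mulN1r !opprB subr_gt0 subr_ge0 => /ltW; exact: ler_powRN.
rewrite plapE//.
have wp : w x `^ (- gamma) =
    h `^ (beta * - gamma) * model_value p gamma a k (y x) l `^ (- gamma).
  by rewrite wE'// powRM ?ltW// -powRrM.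
have hE0 : 0 < h `^ (beta * - gamma) by exact: powR_gt0.
have := ltr_leD (mulr_gt0 hE0 vP) key; rewrite addr0 wp.
by congr (_ < _); ring.
Qed.

(** At the centre the quadratic term vanishes, so w(x0) = (a - l) h^beta, and [sigma * l] is the
    gain. *)
Lemma improvement_at :
  sigma * (u x0 - a * h `^ beta) <= - (rho / 2 * (rho / 2) ^+ 2) * h `^ beta.
Proof.
have rh := mulr_gt0 rho0 h0.
(* Any radius strictly between rho h / 2, beyond which [u] and [w] are ordered, and rho h, up to
   which the barrier is controlled, would do. *)
have r12 : rho * h / 2 < rho * h * (3 / 4) by lra.
have r2r : rho * h * (3 / 4) < rho * h by lra.
have K2O : cube x0 (rho * h * (3 / 4)) `<=` Omega.
  exact: subset_trans (cube_sub_ocube r2r) UO.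
have Ux0 : U x0 by move=> j; rewrite subrr normr0 mulr_gt0.
have := @comparison R n.+1 p sigma x0 _ _ _ p1 r12 r2r u (fun x => u x `^ (- gamma))
  (fun i => partial i u) (fun x Ux => cu (UO Ux)) (fun i x Ux => uE i (UO Ux))
  (fun i x Ux => @cdu i x (UO Ux)) cf
  (fun eps z e0 ze => weak_solution_bump ueq K2O e0 ze)
  g g1 g2 dg dg1 cg2 grad_gt0 boundary_order strict_barrier x0 Ux0.
rewrite /= -/(w x0) wE big1 ?mulr0 ?addr0; last first.
  by move=> j _; rewrite subrr expr0n.
rewrite -/h => le0; rewrite -subr_le0; apply: le_trans le0.
rewrite le_eqVlt; apply/orP; left; apply/eqP.
transitivity (sigma * (u x0 - a * h `^ beta) +
  (sigma * k) / 2 * (rho / 2) ^+ 2 * h `^ beta).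
  by rewrite sigmak; ring.
by rewrite /l; ring.
Qed.

End at_point.

Lemma improvement : exists2 d, 0 < d &
  forall x, Omega x -> sigma * (u x - a * x ord0 N `^ beta) <= - d * x ord0 N `^ beta.
Proof.
have b0 : 0 < beta_exponent p gamma by exact: beta_gt0.
have [delta d0 deltaP] := @model_barrier R n p gamma a sigma a0 b0 defect.
(* The bound by 1 keeps the cubes of radius rho h about points at height h inside the half-space. *)
pose rho := Num.min delta 1 / 2.
have m0 : 0 < Num.min delta 1 by rewrite lt_min d0 ltr01.
have rho0 : 0 < rho by rewrite divr_gt0.
have rhom : rho < Num.min delta 1 by rewrite /rho; move: m0; lra.
have /andP[rhod rho1] : (rho < delta) && (rho < 1) by rewrite -lt_min.
exists (rho / 2 * (rho / 2) ^+ 2); first by rewrite mulr_gt0 ?exprn_gt0// divr_gt0.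
by move=> x Ox; exact: (improvement_at Ox deltaP).
Qed.

End improvement.
(** * The one-dimensional symmetry *)

(* The dimension is N = n.+1 >= 1; x_N is [x ord0 ord_max]. *)
Theorem theorem1p2 (R : realType) (n : nat) (p gamma alpha : R)
    (u : 'rV[R]_n.+1 -> R) (c C : R)
    (hp : 1 < p) (hgamma : 1 < gamma) (halpha : 0 < alpha < 1)
    (uC1 : C1_holder_loc alpha (half_space n) u)
    (uC0 : {within closure (half_space n), continuous u})
    (ueq : weak_solution p gamma u)
    (upos : forall x, half_space n x -> 0 < u x)
    (ubd : forall x, boundary (half_space n) x -> u x = 0)
    (hc : 0 < c) (hC : 0 < C)
    (ubounds : forall x, half_space n x ->
       c * x ord0 ord_max `^ beta_exponent p gamma <= u x
         <= C * x ord0 ord_max `^ beta_exponent p gamma) :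
  forall x, closure (half_space n) x ->
    u x = M_const p gamma * x ord0 ord_max `^ beta_exponent p gamma.
Proof.
have [uCk _] := uC1; have b0 := beta_gt0 hp hgamma; have M0 := M_const_gt0 hp hgamma.
set beta := beta_exponent p gamma in ubounds b0 *.
(* The two-sided growth bound makes [S] bounded; it remains to show sup S <= M <= inf S. *)
pose S := [set u x / x ord0 ord_max `^ beta | x in half_space n].
have xb x : half_space n x -> 0 < x ord0 ord_max `^ beta by move=> Ox; exact: powR_gt0.
have Se : half_space n (const_mx 1 : 'rV[R]_n.+1) by rewrite /half_space/= mxE.
have S0 : S !=set0.
  by eexists; exists (const_mx 1).
have Sub : has_ubound S.
  exists C => _ [x Ox <-]; rewrite ler_pdivrMr ?xb//.
  by have /andP[] := ubounds x Ox.
have Slb : has_lbound S.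
  exists c => _ [x Ox <-]; rewrite ler_pdivlMr ?xb//.
  by have /andP[] := ubounds x Ox.
have le_sup x : half_space n x -> u x - sup S * x ord0 ord_max `^ beta <= 0.
  move=> Ox; rewrite subr_le0 -ler_pdivrMr ?xb//.
  by apply: ub_le_sup => //; exists x.
have ge_inf x : half_space n x -> 0 <= u x - inf S * x ord0 ord_max `^ beta.
  move=> Ox; rewrite subr_ge0 -ler_pdivlMr ?xb//.
  by apply: ge_inf => //; exists x.
have supM : sup S <= M_const p gamma.
  rewrite leNgt; apply/negP => MS.
  have defect : 0 < 1 * barrier_defect p gamma (sup S).
    by rewrite mul1r barrier_defect_gt0.
  have ub x : half_space n x -> 1 * (u x - sup S * x ord0 ord_max `^ beta) <= 0.
    by rewrite mul1r; exact: le_sup.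
  have [d d0 dP] := improvement hp hgamma (lt_trans M0 MS) (or_introl erefl)
    defect uCk ueq upos ub.
  (* The gain is a fixed multiple of x_N^beta, so sup S - d is again an upper bound of [S]. *)
  have : sup S <= sup S - d.
    apply: ge_sup => // _ [x Ox <-]; rewrite ler_pdivrMr ?xb//.
    by have := dP x Ox; rewrite mul1r mulNr mulrBl lerBlDr addrC.
  by move: d0; lra.
have infM : M_const p gamma <= inf S.
  rewrite leNgt; apply/negP => SM.
  (* The lower growth bound makes inf S an admissible coefficient for a barrier. *)
  have i0 : 0 < inf S.
    apply: (lt_le_trans hc); apply: lb_le_inf => // _ [x Ox <-].
    rewrite ler_pdivlMr ?xb//.
    by have /andP[] := ubounds x Ox.
  have defect : 0 < -1 * barrier_defect p gamma (inf S).
    by rewrite mulN1r oppr_gt0 barrier_defect_lt0.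
  have ub x : half_space n x -> -1 * (u x - inf S * x ord0 ord_max `^ beta) <= 0.
    by rewrite mulN1r oppr_le0; exact: ge_inf.
  have [d d0 dP] := improvement hp hgamma i0 (or_intror erefl)
    defect uCk ueq upos ub.
  have : inf S + d <= inf S.
    apply: lb_le_inf => // _ [x Ox <-]; rewrite ler_pdivlMr ?xb//.
    by have := dP x Ox; lra.
  by move: d0; lra.
move=> x cx; have [Ox|Ox] := pselect (half_space n x).
  apply/eqP; rewrite eq_le; apply/andP; split.
    have := le_sup x Ox; rewrite subr_le0 => /le_trans; apply.
    by rewrite ler_wpM2r// ltW// xb.
  have := ge_inf x Ox; rewrite subr_ge0; apply: le_trans.
  by rewrite ler_wpM2r// ltW// xb.
have xN : x ord0 ord_max = 0.
  by apply/eqP; rewrite eq_le closure_half_space// andbT leNgt; apply/negP.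
(* On the boundary both sides are 0, because the power of 0 is 0 for beta > 0. *)
rewrite ubd ?xN ?powR0 ?mulr0 ?gt_eqF//.
by split => // /interior_subset.
Qed.
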